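(* Let $\mathfrak f\colon\mathfrak R\to\mathfrak S$ be a continuous homomorphism of complete, separated right linear topological rings with countable bases of neighborhoods of zero. Assume that the functor of restriction of scalars $\mathfrak f_\sharp\colon\mathfrak S\text{-}\mathsf{Contra}\to\mathfrak R\text{-}\mathsf{Contra}$ takes flat left $\mathfrak S$-contramodules to flat left $\mathfrak R$-contramodules. Then the following three conditions are equivalent: (1) the functor $\mathfrak f_\sharp\colon\mathfrak S\text{-}\mathsf{Flat}\to\mathfrak R\text{-}\mathsf{Flat}$ is fully faithful; (2) the functor $\mathfrak f_\sharp\colon\mathfrak S\text{-}\mathsf{Separ}\to\mathfrak R\text{-}\mathsf{Separ}$ is fully faithful; (3) the functor $\mathfrak f_\sharp\colon\mathfrak S\text{-}\mathsf{Contra}\to\mathfrak R\text{-}\mathsf{Contra}$ is fully faithful.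
   Context: All rings are associative and unital. A topological ring is right linear if open right ideals form a base of neighborhoods of zero; it is complete and separated if the natural map to the projective limit of its quotients by all open subgroups is bijective. Contramodules. Let $\mathfrak R$ be a complete, separated right linear topological ring. For a set $X$, let $\mathfrak R[[X]]$ be the set of all infinite formal linear combinations $\sum_{x\in X}r_xx$ whose coefficient families $(r_x\in\mathfrak R)_{x\in X}$ converge to zero (for every open subgroup $\mathfrak U\subset\mathfrak R$, $r_x\in\mathfrak U$ for all but finitely many $x$). A map $g\colon X\to Y$ induces $\mathfrak R[[g]]\colon\sum_x r_xx\mapsto\sum_y\bigl(\sum_{g(x)=y}r_x\bigr)y$, where infinite sums in $\mathfrak R$ are limits of finite partial sums. The functor $\mathfrak R[[-]]$ is a monad on sets with unit $\epsilon_X\colon x\mapsto 1\cdot x$ and multiplication $\phi_X\colon\mathfrak R[[\mathfrak R[[X]]]]\to\mathfrak R[[X]]$ given by opening parentheses. A left $\mathfrak R$-contramodule is a module (algebra) over this monad, i.e. a set $\mathfrak P$ with a map $\pi_{\mathfrak P}\colon\mathfrak R[[\mathfrak P]]\to\mathfrak P$ satisfying $\pi_{\mathfrak P}\epsilon_{\mathfrak P}=\mathrm{id}$ and $\pi_{\mathfrak P}\circ\mathfrak R[[\pi_{\mathfrak P}]]=\pi_{\mathfrak P}\circ\phi_{\mathfrak P}$. The category $\mathfrak R\text{-}\mathsf{Contra}$ of left $\mathfrak R$-contramodules is abelian; restricting $\pi_{\mathfrak P}$ to finite linear combinations gives an exact forgetful functor to left $\mathfrak R$-modules. For an open right ideal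 $\mathfrak I\subset\mathfrak R$, $\mathfrak I\rightthreetimes\mathfrak P\subset\mathfrak P$ is the image under $\pi_{\mathfrak P}$ of the set of those elements of $\mathfrak R[[\mathfrak P]]$ whose coefficients all lie in $\mathfrak I$. The contramodule $\mathfrak P$ is separated if $\bigcap_{\mathfrak I}(\mathfrak I\rightthreetimes\mathfrak P)=0$, the intersection being over all open right ideals. $\mathfrak R\text{-}\mathsf{Separ}\subset\mathfrak R\text{-}\mathsf{Contra}$ is the full subcategory of separated left contramodules. A right $\mathfrak R$-module is discrete if the annihilator of each of its elements is open in $\mathfrak R$. For a discrete right $\mathfrak R$-module $\mathcal N$ and a left $\mathfrak R$-contramodule $\mathfrak P$, the contratensor product $\mathcal N\odot_{\mathfrak R}\mathfrak P$ is the cokernel of the difference of the two maps $\mathcal N\otimes_{\mathbb Z}\mathfrak R[[\mathfrak P]]\rightrightarrows\mathcal N\otimes_{\mathbb Z}\mathfrak P$, the first being $\mathrm{id}\otimes\pi_{\mathfrak P}$ and the second $y\otimes\sum_pr_pp\mapsto\sum_p yr_p\otimes p$ (a finite sum). A left $\mathfrak R$-contramodule $\mathfrak F$ is flat if $-\odot_{\mathfrak R}\mathfrak F$ is an exact functor from discrete right $\mathfrak R$-modules to abelian groups. $\mathfrak R\text{-}\mathsf{Flat}\subset\mathfrak R\text{-}\mathsf{Contra}$ is the full subcategory of flat left contramodules. Restriction of scalars. A continuous ring homomorphism $\mathfrak f\colon\mathfrak R\to\mathfrak S$ induces maps $\mathfrak R[[X]]\to\mathfrak S[[X]]$ (apply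 $\mathfrak f$ to coefficients); precomposing $\pi_{\mathfrak Q}\colon\mathfrak S[[\mathfrak Q]]\to\mathfrak Q$ with $\mathfrak R[[\mathfrak Q]]\to\mathfrak S[[\mathfrak Q]]$ defines the functor $\mathfrak f_\sharp\colon\mathfrak S\text{-}\mathsf{Contra}\to\mathfrak R\text{-}\mathsf{Contra}$. It takes separated contramodules to separated contramodules. *)

(* Defs.v *)
From HB Require Import structures.
From mathcomp Require Import all_boot all_order all_algebra finmap.
From mathcomp Require Import boolp classical_sets functions cardinality fsbigop.
From mathcomp Require Import filter topology tvs summability.
From mathcomp.multinomials Require Import freeg.

Set Implicit Arguments.
Unset Strict Implicit.
Unset Printing Implicit Defensive.

Import GRing.Theory.
Local Open Scope classical_set_scope.
Local Open Scope ring_scope.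
Local Open Scope quotient_scope.

(* [pzRingType] allows the zero ring. *)
HB.mixin Record TopologicalZmodule_isTopPzRing R
    & TopologicalZmodule R & GRing.PzRing R := {
  mul_continuous : continuous (fun x : R * R => x.1 * x.2)
}.

#[short(type="topPzRingType")]
HB.structure Definition TopPzRing :=
  {R of TopologicalZmodule R & GRing.PzRing R
      & TopologicalZmodule_isTopPzRing R}.

Section TopRing.
Variable R : topPzRingType.

Definition open_subgroup (U : set R) :=
  [/\ open U, U 0 & forall x y, U x -> U y -> U (x - y)].

Definition open_right_ideal (I : set R) :=
  open_subgroup I /\ forall x r, I x -> I (x * r).

Definition right_linear :=
  forall A : set R, nbhs 0 A -> exists2 I, open_right_ideal I & I `<=` A.

Definition countable_base0 :=
  exists2 B : set (set R), countable B & nbhs (0 : R) = filter_from B id.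

Definition addcoset (U : set R) (r : R) : set R := [set s | U (s - r)].

(* The projective limit of the quotient groups R/U, an element of R/U being a
   coset of U: for U contained in V, the transition map R/U -> R/V sends a
   coset of U to the unique coset of V containing it. *)
Definition quotient_limit : set ({U | open_subgroup U} -> set R) :=
  [set c | (forall U, exists r, c U = addcoset (sval U) r)
         /\ (forall U V, sval U `<=` sval V -> c U `<=` c V)].

Definition complete_separated :=
  set_bij [set: R] quotient_limit (fun r U => addcoset (sval U) r).

End TopRing.

HB.mixin Record TopPzRing_isCRL R & TopPzRing R := {
  right_linearP : right_linear R ;
  complete_separatedP : complete_separated R
}.

(* complete, separated right linear topological rings *)
#[short(type="crlRingType")]
HB.structure Definition CRLRing := {R of TopPzRing R & TopPzRing_isCRL R}.

Section Infsum.
Variable R : topPzRingType.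

Definition cvg_zero (X : Type) (r : X -> R) :=
  forall U : set R, open_subgroup U -> finite_set [set x | ~ U (r x)].

Definition infsum (X : Type) (r : X -> R) : R :=
  xget 0 [set s | partial_sum (r : {classic X} -> R) @ totally --> s].

End Infsum.

Section SubgroupSums.
Variables (V : zmodType) (U : set V).
Hypotheses (U0 : U 0) (UB : forall x y, U x -> U y -> U (x - y)).

Lemma subgroupN x : U x -> U (- x).
Proof. by move=> Ux; rewrite -sub0r; exact: UB. Qed.

Lemma subgroupD x y : U x -> U y -> U (x + y).
Proof. by move=> Ux Uy; rewrite -[y]opprK; apply/UB/subgroupN. Qed.

Lemma subgroup_sum (I : Type) (s : seq I) (P : pred I) (F : I -> V) :
  (forall i, P i -> U (F i)) -> U (\sum_(i <- s | P i) F i).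
Proof. by move=> UF; elim/big_ind: _ => //; exact: subgroupD. Qed.

Lemma subgroup_trans y x z : U (x - y) -> U (y - z) -> U (x - z).
Proof. by move=> xy yz; rewrite -(subrKA y); exact: subgroupD. Qed.

Lemma subgroup_sym x y : U (x - y) -> U (y - x).
Proof. by move=> /subgroupN; rewrite opprB. Qed.

Lemma sum_fsubset (X : choiceType) (r : X -> V) (A B : {fset X}) :
  (A `<=` B)%fset -> (forall x, x \notin A -> U (r x)) ->
  U (\sum_(x <- B) r x - \sum_(x <- A) r x).
Proof.
move=> AB Ur; rewrite (bigID (mem A)) /= addrC.
have -> : \sum_(x <- B | x \in A) r x = \sum_(x <- A) r x.
  rewrite -big_filter; apply: perm_big; apply: uniq_perm => //.
    exact/filter_uniq/fset_uniq.
  move=> x; rewrite mem_filter /=.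
  by case xA: (x \in A) => //=; exact: (fsubsetP AB).
by rewrite addrK; apply: subgroup_sum => x; exact: Ur.
Qed.

End SubgroupSums.

Section InfsumTheory.
Variable R : crlRingType.
Implicit Types (U I : set R).

Lemma open_subgroup_nbhs U (x : R) : open_subgroup U -> nbhs x (addcoset U x).
Proof.
move=> [oU U0 _].
have -> : addcoset U x = (fun y => y - x) @^-1` U by [].
have c : continuous (fun y : R => y - x).
  move=> y.
  apply: (@continuous_comp _ _ _ (fun y => (y, - x)) (fun z : R * R => z.1 + z.2)).
    by apply: cvg_pair; [exact: cvg_id|exact: cvg_cst].
  exact: add_continuous.
by apply: c; rewrite subrr; exact: open_nbhs_nbhs.
Qed.

Lemma mull_continuous (c : R) : continuous ( *%R c).
Proof.
move=> y.
apply: (@continuous_comp _ _ _ (fun y => (c, y)) (fun z : R * R => z.1 * z.2)).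
  by apply: cvg_pair; [exact: cvg_cst|exact: cvg_id].
exact: mul_continuous.
Qed.

Lemma mulr_continuous (c : R) : continuous (fun x : R => x * c).
Proof.
move=> y.
apply: (@continuous_comp _ _ _ (fun y => (y, c)) (fun z : R * R => z.1 * z.2)).
  by apply: cvg_pair; [exact: cvg_id|exact: cvg_cst].
exact: mul_continuous.
Qed.

Lemma open_subgroup_mull U (c : R) :
  open_subgroup U -> open_subgroup [set x | U (c * x)].
Proof.
move=> [oU U0 UB]; split; first by move/continuousP: (@mull_continuous c); apply.
  by rewrite /= mulr0.
by move=> x y /= Ux Uy; rewrite mulrBr; exact: UB.
Qed.

Lemma open_subgroup_mulr U (c : R) :
  open_subgroup U -> open_subgroup [set x | U (x * c)].
Proof.
move=> [oU U0 UB]; split; first by move/continuousP: (@mulr_continuous c); apply.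
  by rewrite /= mul0r.
by move=> x y /= Ux Uy; rewrite mulrBl; exact: UB.
Qed.

Lemma open_subgroup_right_ideal U :
  open_subgroup U -> exists2 I, open_right_ideal I & I `<=` U.
Proof. by move=> [oU U0 _]; apply: right_linearP; exact: open_nbhs_nbhs. Qed.

Lemma eq_mod_open (x y : R) :
  (forall U, open_subgroup U -> U (x - y)) -> x = y.
Proof.
move=> xy; have [_ inj _] := @complete_separatedP R.
apply: inj; rewrite ?inE //; apply/funext => -[U oU] /=.
have [_ U0 UB] := oU.
have Uxy := xy _ oU; have Uyx := subgroup_sym U0 UB Uxy.
by apply/seteqP; split=> z /= Uz; apply: (subgroup_trans U0 UB Uz).
Qed.

Lemma cvg_zero_fset (X : Type) (r : X -> R) U : cvg_zero r -> open_subgroup U ->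
  exists A : {fset {classic X}}, forall x, x \notin A -> U (r x).
Proof.
move=> r0 oU; exists (fset_set ([set x | ~ U (r x)] : set {classic X})) => x.
rewrite in_fset_set; last exact: r0.
by move=> /negP xA; apply: contrapT => Ux; apply: xA; rewrite inE.
Qed.

Lemma infsum_cvg (X : Type) (r : X -> R) : cvg_zero r ->
  partial_sum (r : {classic X} -> R) @ totally --> infsum r.
Proof.
move=> r0; rewrite /infsum.
suff [s sP] : exists s : R, partial_sum (r : {classic X} -> R) @ totally --> s.
  by case: xgetP => [//|/(_ s) []].
pose A (U : {U : set R | open_subgroup U}) := sval (cid (cvg_zero_fset r0 (svalP U))).
have AP (U : {U : set R | open_subgroup U}) x : x \notin A U -> sval U (r x).
  by rewrite /A; case: cid => /= B; apply.
have [_ _ /(_ (fun U : {U : set R | open_subgroup U} => addcoset (sval U) (\sum_(x <- A U) r x)))] :=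
  @complete_separatedP R.
have AB (U : {U : set R | open_subgroup U}) (C : {fset {classic X}}) :
    (forall x, x \notin C -> sval U (r x)) ->
    sval U (\sum_(x <- C) r x - \sum_(x <- A U) r x).
  move=> CU; have [_ U0 UB] := svalP U.
  apply: (subgroup_trans U0 UB (y := \sum_(x <- (C `|` A U)%fset) r x)).
    apply: (subgroup_sym U0 UB); apply: (sum_fsubset U0 UB) => //.
    exact: fsubsetUl.
  by apply: (sum_fsubset U0 UB) => //; [exact: fsubsetUr|exact: AP].
case.
  split=> [U|U V UV]; first by exists (\sum_(x <- A U) r x).
  move=> z /= Uz; have [_ V0 VB] := svalP V.
  apply: (subgroup_trans V0 VB (UV _ Uz)).
  by apply: AB => x /AP /UV.
move=> s _ sE; exists s => N.
have -> : nbhs s N = nbhs (0 + s) N by rewrite add0r.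
move=> Ns; have : nbhs 0 ((fun y => y + s) @^-1` N).
  have c : {for (0 : R), continuous (fun y : R => y + s)}.
    apply: (@continuous_comp _ _ _ (fun y => (y, s)) (fun z : R * R => z.1 + z.2)).
      by apply: cvg_pair; [exact: cvg_id|exact: cvg_cst].
    exact: add_continuous.
  exact: c.
move=> /(@right_linearP R)[I [oI _] IN].
pose U : {U : set R | open_subgroup U} := exist _ I oI.
have [_ U0 UB] := oI.
have := congr1 (fun h => h U) sE; rewrite /= => sU.
have Us : I (s - \sum_(x <- A U) r x).
  have : addcoset I s s by rewrite /addcoset /= subrr.
  by rewrite sU.
exists (A U) => // B /= AUB.
rewrite -[X in N X](subrK s); apply: IN.
apply: (subgroup_trans U0 UB); last exact: (subgroup_sym U0 UB Us).
rewrite /partial_sum -(big_seq_fsetE _ _ xpredT (r : {classic X} -> R)) /=.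
by apply: (sum_fsubset U0 UB) => // x; exact: (AP U).
Qed.

Lemma infsum_mod (X : Type) (r : X -> R) U (A : {fset {classic X}}) :
  cvg_zero r -> open_subgroup U -> (forall x, x \notin A -> U (r x)) ->
  U (infsum r - \sum_(x <- A) r x).
Proof.
move=> r0 oU rU; have [_ U0 UB] := oU.
have [B _ BP] := infsum_cvg r0 (open_subgroup_nbhs (infsum r) oU).
have /BP /= : (B `<=` B `|` A)%fset by exact: fsubsetUl.
rewrite /partial_sum -(big_seq_fsetE _ _ xpredT (r : {classic X} -> R)) /=.
move=> /(subgroup_sym U0 UB) h; apply: (subgroup_trans U0 UB h).
by apply: (sum_fsubset U0 UB) => //; exact: fsubsetUr.
Qed.

Lemma infsum_open (X : Type) (r : X -> R) U :
  cvg_zero r -> open_subgroup U -> (forall x, U (r x)) -> U (infsum r).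
Proof.
move=> r0 oU rU; have := @infsum_mod X r U fset0 r0 oU (fun x _ => rU x).
by rewrite big_seq_fset0 subr0.
Qed.

Lemma cvg_zero_sub (X : Type) (r r' : X -> R) :
  (forall U, open_subgroup U -> forall x, U (r x) -> U (r' x)) ->
  cvg_zero r -> cvg_zero r'.
Proof.
move=> sub r0 U oU; apply: sub_finite_set (r0 U oU) => x /= nU Ur.
by apply: nU; exact: sub.
Qed.

Lemma cvg_zero_if (X : Type) (r : X -> R) (P : pred X) :
  cvg_zero r -> cvg_zero (fun x => if P x then r x else 0).
Proof. by apply: cvg_zero_sub => U [_ U0 _] x; case: ifP. Qed.

Lemma cvg_zeroD (X : Type) (r r' : X -> R) :
  cvg_zero r -> cvg_zero r' -> cvg_zero (fun x => r x + r' x).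
Proof.
move=> r0 r0' U oU; have [_ U0 UB] := oU.
apply: (@sub_finite_set _ _ ([set x | ~ U (r x)] `|` [set x | ~ U (r' x)])).
  move=> x /= nU; apply: contrapT => /not_orP[/contrapT Ur /contrapT Ur'].
  by apply: nU; apply: subgroupD.
by rewrite finite_setU; split; [exact: r0|exact: r0'].
Qed.

Lemma cvg_zeroN (X : Type) (r : X -> R) :
  cvg_zero r -> cvg_zero (fun x => - r x).
Proof. by apply: cvg_zero_sub => U [_ U0 UB] x; exact: subgroupN. Qed.

Lemma cvg_zero_mulr (X : Type) (r s : X -> R) :
  cvg_zero r -> cvg_zero (fun x => r x * s x).
Proof.
move=> r0 U /open_subgroup_right_ideal[I [oI Im] IU].
apply: sub_finite_set (r0 I oI) => x /= nU Ir.
by apply: nU; apply/IU/Im.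
Qed.

Lemma infsumD (X : Type) (r r' : X -> R) : cvg_zero r -> cvg_zero r' ->
  infsum (fun x => r x + r' x) = infsum r + infsum r'.
Proof.
move=> r0 r0'; apply: eq_mod_open => U oU; have [_ U0 UB] := oU.
have [A AP] := cvg_zero_fset r0 oU; have [B BP] := cvg_zero_fset r0' oU.
pose C := (A `|` B)%fset.
have CA x : x \notin C -> U (r x).
  by rewrite inE negb_or => /andP[/AP].
have CB x : x \notin C -> U (r' x).
  by rewrite inE negb_or => /andP[_ /BP].
have h := infsum_mod r0 oU CA; have h' := infsum_mod r0' oU CB.
have CAB x : x \notin C -> U (r x + r' x).
  by move=> xC; apply: subgroupD => //; [exact: CA|exact: CB].
apply: (subgroup_trans U0 UB (infsum_mod (cvg_zeroD r0 r0') oU CAB)).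
apply: (subgroup_sym U0 UB); rewrite big_split /= opprD addrACA.
exact: subgroupD.
Qed.

Lemma infsum_mulr (X : Type) (r : X -> R) (c : R) : cvg_zero r ->
  infsum (fun x => r x * c) = infsum r * c.
Proof.
move=> r0; apply: eq_mod_open => U oU; have [_ U0 UB] := oU.
have oUc := open_subgroup_mulr c oU.
have [A AP] := cvg_zero_fset r0 oUc.
have /= h := infsum_mod r0 oUc AP.
have r0c : cvg_zero (fun x => r x * c) by exact: cvg_zero_mulr.
apply: (subgroup_trans U0 UB (infsum_mod r0c oU AP)).
by apply: (subgroup_sym U0 UB); move: h; rewrite mulrBl mulr_suml.
Qed.

Lemma infsum0 (X : Type) : infsum (fun _ : X => 0 : R) = 0.
Proof.
apply: eq_mod_open => U oU; have [_ U0 _] := oU.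
rewrite subr0; apply: infsum_open => //.
by move=> V [_ V0 _]; apply: (@sub_finite_set _ _ set0).
Qed.

Lemma infsum_single (X : Type) (x0 : X) (r : X -> R) :
  (forall x, x <> x0 -> r x = 0) -> infsum r = r x0.
Proof.
move=> rE.
have rU U x : open_subgroup U -> x <> x0 -> U (r x).
  by move=> [_ U0 _] /rE ->.
have r0 : cvg_zero r.
  move=> U oU; apply: (@sub_finite_set _ _ [set x0]); last exact: finite_set1.
  by move=> x /= nU; apply: contrapT => /(rU _ _ oU).
apply: eq_mod_open => U oU.
have := @infsum_mod X r U [fset (x0 : {classic X})]%fset r0 oU.
rewrite big_seq_fset1; apply=> x; rewrite inE => /eqP xx0.
exact: rU.
Qed.

Lemma infsum_fiber (X Y : Type) (g : X -> Y) (r : X -> R) : cvg_zero r ->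
  infsum (fun y => infsum (fun x => if `[< g x = y >] then r x else 0))
  = infsum r.
Proof.
move=> r0; set q := fun y => infsum _.
have ry0 y : cvg_zero (fun x => if `[< g x = y >] then r x else 0).
  exact: cvg_zero_if.
have qU (U : set R) (A : {fset {classic X}}) (y : Y) : open_subgroup U ->
    (forall x, x \notin A -> U (r x)) ->
    U (q y - \sum_(x <- A) if `[< g x = y >] then r x else 0).
  move=> oU AP; apply: (infsum_mod (ry0 y) oU) => x /AP.
  by case: ifP => // _ _; case: oU.
have qE (U : set R) (A : {fset {classic X}}) (y : Y) : open_subgroup U ->
    (forall x, x \notin A -> U (r x)) ->
    (forall x, x \in A -> g x <> y) -> U (q y).
  move=> oU AP gA; have := qU U A y oU AP.
  rewrite big_seq big1 ?subr0// => x /gA gx.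
  by case: asboolP.
have q0 : cvg_zero q.
  move=> U oU; have [A AP] := cvg_zero_fset r0 oU.
  apply: (@sub_finite_set _ _ (g @` [set` A])); last exact/finite_image/finite_fset.
  move=> y /= nU; apply: contrapT => nA; apply: nU; apply: (qE U A) => // x xA gx.
  by apply: nA; exists x.
apply: eq_mod_open => U oU; have [_ U0 UB] := oU.
have [A AP] := cvg_zero_fset r0 oU.
pose B : {fset {classic Y}} := [fset (g : {classic X} -> {classic Y}) x | x in A]%fset.
have BP y : y \notin B -> U (q y).
  move=> yB; apply: (qE U A) => // x xA gx; move/negP: yB; apply.
  by apply/imfsetP; exists x.
apply: (subgroup_trans U0 UB (infsum_mod q0 oU BP)).
apply: (subgroup_trans U0 UB); last exact: (subgroup_sym U0 UB (infsum_mod r0 oU AP)).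
have -> : \sum_(x <- A) r x =
    \sum_(y <- B) \sum_(x <- A) if `[< g x = y >] then r x else 0.
  rewrite exchange_big /= big_seq [RHS]big_seq; apply: eq_bigr => x xA.
  rewrite (big_rem (g x : {classic Y})) /=; last by apply/imfsetP; exists x.
  rewrite asboolT // big_seq big1 ?addr0 // => y.
  rewrite mem_rem_uniq ?fset_uniq // inE => /andP[/eqP ygx _].
  by case: asboolP => // /esym.
rewrite -sumrB; apply: (subgroup_sum U0 UB) => y _.
exact: qU.
Qed.

End InfsumTheory.

Section InfsumMorph.
Variables (R S : crlRingType) (f : {rmorphism R -> S}) (fc : continuous f).

Lemma open_subgroup_preimage (U : set S) :
  open_subgroup U -> open_subgroup (f @^-1` U).
Proof.
move=> [oU U0 UB]; split; first by move/continuousP: fc; apply.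
  by rewrite /= rmorph0.
by move=> x y /= Ux Uy; rewrite rmorphB; exact: UB.
Qed.

Lemma cvg_zero_morph (X : Type) (r : X -> R) :
  cvg_zero r -> cvg_zero (fun x => f (r x)).
Proof. by move=> r0 U /open_subgroup_preimage /r0. Qed.

Lemma infsum_morph (X : Type) (r : X -> R) : cvg_zero r ->
  infsum (fun x => f (r x)) = f (infsum r).
Proof.
move=> r0; apply: eq_mod_open => U oU; have [_ U0 UB] := oU.
have oUf := open_subgroup_preimage oU.
have [A AP] := cvg_zero_fset r0 oUf.
have /= h := infsum_mod r0 oUf AP.
apply: (subgroup_trans U0 UB (infsum_mod (cvg_zero_morph r0) oU AP)).
by apply: (subgroup_sym U0 UB); move: h; rewrite rmorphB rmorph_sum.
Qed.

End InfsumMorph.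

(* [lincomb R X] is the set R[[X]]. *)
Record lincomb (R : topPzRingType) (X : Type) := LinComb {
  lcoef :> X -> R ;
  lcoef_cvg0 : cvg_zero lcoef
}.

Lemma lincombP (R : topPzRingType) (X : Type) (s t : lincomb R X) :
  (forall x, s x = t x) -> s = t.
Proof.
case: s t => [s s0] [t t0] /= /funext st; case: _ / st t0 => t0.
by congr LinComb; exact: Prop_irrelevance.
Qed.

HB.instance Definition _ (R : topPzRingType) (X : Type) :=
  Choice.copy (lincomb R X) {classic (lincomb R X)}.

Section LinCombZmod.
Variables (R : crlRingType) (X : Type).

Lemma cvg_zero0 : cvg_zero (fun _ : X => 0 : R).
Proof.
move=> U [_ U0 _]; apply: (@sub_finite_set _ _ set0); last exact: finite_set0.
by move=> x /=.
Qed.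

Definition lc_zero := LinComb cvg_zero0.
Definition lc_opp (s : lincomb R X) := LinComb (cvg_zeroN (lcoef_cvg0 s)).
Definition lc_add (s t : lincomb R X) :=
  LinComb (cvg_zeroD (lcoef_cvg0 s) (lcoef_cvg0 t)).

Lemma lc_addA : associative lc_add.
Proof. by move=> s t u; apply: lincombP => x /=; rewrite addrA. Qed.
Lemma lc_addC : commutative lc_add.
Proof. by move=> s t; apply: lincombP => x /=; rewrite addrC. Qed.
Lemma lc_add0 : left_id lc_zero lc_add.
Proof. by move=> s; apply: lincombP => x /=; rewrite add0r. Qed.
Lemma lc_addN : left_inverse lc_zero lc_opp lc_add.
Proof. by move=> s; apply: lincombP => x /=; rewrite addNr. Qed.

HB.instance Definition _ :=
  GRing.isZmodule.Build (lincomb R X) lc_addA lc_addC lc_add0 lc_addN.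

End LinCombZmod.

Section Monad.
Variable R : crlRingType.

Lemma lc_unit_subproof (X : Type) (x : X) :
  cvg_zero (fun y => (`[< y = x >])%:R : R).
Proof.
move=> U [_ U0 _]; apply: (@sub_finite_set _ _ [set x]); last exact: finite_set1.
by move=> y /=; case: asboolP.
Qed.

Definition lc_unit (X : Type) (x : X) : lincomb R X :=
  LinComb (@lc_unit_subproof X x).

Lemma lc_map_subproof (X Y : Type) (g : X -> Y) (t : lincomb R X) :
  cvg_zero (fun y => infsum (fun x => if `[< g x = y >] then t x else 0)).
Proof.
move=> U oU; have [_ U0 _] := oU.
apply: (@sub_finite_set _ _ (g @` [set x | ~ U (t x)])).
  move=> y /= nU; apply: contrapT => nA; apply: nU.
  apply: infsum_open => //; first exact/cvg_zero_if/lcoef_cvg0.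
  move=> x; case: asboolP => // gx; apply: contrapT => nU.
  by apply: nA; exists x.
exact/finite_image/lcoef_cvg0.
Qed.

Definition lc_map (X Y : Type) (g : X -> Y) (t : lincomb R X) : lincomb R Y :=
  LinComb (lc_map_subproof g t).

Lemma lc_join_subproof (X : Type) (t : lincomb R (lincomb R X)) :
  cvg_zero (fun x => infsum (fun a : lincomb R X => t a * a x)).
Proof.
move=> U /open_subgroup_right_ideal[I [oI Im] IU].
apply: (@sub_finite_set _ _
  (\bigcup_(a in [set a | ~ I (t a)]) [set x | ~ I (t a * a x)])).
  move=> x /= nU; apply: contrapT => nA; apply: nU; apply: IU.
  apply: infsum_open => //; first exact/cvg_zero_mulr/lcoef_cvg0.
  move=> a; apply: contrapT => nI; apply: nA; exists a => //=.
  by move=> Ia; apply: nI; exact: Im.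
apply: bigcup_finite; first exact: lcoef_cvg0.
by move=> a _; apply: (lcoef_cvg0 a (open_subgroup_mull (t a) oI)).
Qed.

(* opening of parentheses *)
Definition lc_join (X : Type) (t : lincomb R (lincomb R X)) : lincomb R X :=
  LinComb (lc_join_subproof t).

Lemma lc_mapD (X Y : Type) (g : X -> Y) (s t : lincomb R X) :
  lc_map g (s + t) = lc_map g s + lc_map g t.
Proof.
apply: lincombP => y /=.
rewrite -infsumD; [|exact/cvg_zero_if/lcoef_cvg0..].
by congr infsum; apply/funext => x /=; case: ifP => //; rewrite addr0.
Qed.

Lemma lc_map_unit (X Y : Type) (g : X -> Y) (x : X) :
  lc_map g (lc_unit x) = lc_unit (g x).
Proof.
apply: lincombP => y /=; rewrite (@infsum_single _ _ x) => [|z zx].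
  rewrite (asboolT (erefl x)); case: asboolP => [->|gy].
    by rewrite asboolT.
  by rewrite asboolF // => yg; apply: gy.
by rewrite (asboolF zx); case: ifP.
Qed.

Lemma lc_map_comp (X Y Z : Type) (g : X -> Y) (h : Y -> Z) (t : lincomb R X) :
  lc_map (h \o g) t = lc_map h (lc_map g t).
Proof.
apply: lincombP => z /=.
rewrite -[LHS](infsum_fiber g); last exact/cvg_zero_if/lcoef_cvg0.
congr infsum; apply/funext => y; case: asboolP => hy.
  congr infsum; apply/funext => x; case: asboolP => // gx.
  by rewrite asboolT //= gx.
rewrite -[RHS](@infsum0 R X); congr infsum; apply/funext => x.
by case: asboolP => // gx; rewrite asboolF //= gx.
Qed.

Lemma lc_joinD (X : Type) (s t : lincomb R (lincomb R X)) :
  lc_join (s + t) = lc_join s + lc_join t.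
Proof.
apply: lincombP => x /=.
rewrite -infsumD; [|exact/cvg_zero_mulr/lcoef_cvg0..].
by congr infsum; apply/funext => a /=; rewrite mulrDl.
Qed.

Lemma lc_join_unit (X : Type) (s : lincomb R X) : lc_join (lc_unit s) = s.
Proof.
apply: lincombP => x /=; rewrite (@infsum_single _ _ s) => [|a /asboolF ->].
  by rewrite asboolT // mul1r.
by rewrite mul0r.
Qed.

End Monad.

Record contramodule (R : crlRingType) := Contramodule {
  cm_sort :> Type ;
  cm_pi : lincomb R cm_sort -> cm_sort ;
  cm_unit : forall p, cm_pi (lc_unit R p) = p ;
  cm_assoc : forall t, cm_pi (lc_map cm_pi t) = cm_pi (lc_join t)
}.
Arguments cm_pi {R} _ _.

HB.instance Definition _ (R : crlRingType) (P : contramodule R) :=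
  Choice.copy (cm_sort P) {classic (cm_sort P)}.

(* The group structure is not part of the data: p + q is the value of [cm_pi]
   on the formal linear combination 1 p + 1 q. *)
Section ContramoduleZmod.
Variables (R : crlRingType) (P : contramodule R).
Local Notation u := (@lc_unit R P).

Definition cm_zero : P := cm_pi P 0.
Definition cm_opp (p : P) : P := cm_pi P (- u p).
Definition cm_add (p q : P) : P := cm_pi P (u p + u q).

Lemma cm_piD_subproof s t : cm_pi P (s + t) = cm_add (cm_pi P s) (cm_pi P t).
Proof.
by rewrite /cm_add -!lc_map_unit -lc_mapD cm_assoc lc_joinD !lc_join_unit.
Qed.

Lemma cm_addA : associative cm_add.
Proof.
move=> p q r; rewrite -[p in LHS]cm_unit -[r in RHS]cm_unit.
by rewrite -!cm_piD_subproof addrA.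
Qed.

Lemma cm_addC : commutative cm_add.
Proof. by move=> p q; rewrite /cm_add addrC. Qed.

Lemma cm_add0 : left_id cm_zero cm_add.
Proof.
by move=> p; rewrite -[p in LHS]cm_unit -cm_piD_subproof add0r cm_unit.
Qed.

Lemma cm_addN : left_inverse cm_zero cm_opp cm_add.
Proof.
by move=> p; rewrite -[p in X in cm_add _ X]cm_unit -cm_piD_subproof addNr.
Qed.

HB.instance Definition _ :=
  GRing.isZmodule.Build (cm_sort P) cm_addA cm_addC cm_add0 cm_addN.

Lemma cm_piD : {morph cm_pi P : s t / s + t}.
Proof. exact: cm_piD_subproof. Qed.

End ContramoduleZmod.

Record contra_hom (R : crlRingType) (P Q : contramodule R) := ContraHom {
  contra_fun :> P -> Q ;
  contra_homP : forall t, contra_fun (cm_pi P t) = cm_pi Q (lc_map contra_fun t)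
}.

Definition ideal_act (R : crlRingType) (I : set R) (P : contramodule R) : set P :=
  cm_pi P @` [set t : lincomb R P | forall p, I (t p)].
Arguments ideal_act {R} I P _.

Definition cm_separated (R : crlRingType) (P : contramodule R) :=
  \bigcap_(I in @open_right_ideal R) ideal_act I P = [set 0].

Section Restriction.
Variables (R S : crlRingType) (f : {rmorphism R -> S}) (fc : continuous f).

Definition lc_scalars (X : Type) (t : lincomb R X) : lincomb S X :=
  LinComb (cvg_zero_morph fc (lcoef_cvg0 t)).

Lemma lc_scalars_unit (X : Type) (x : X) :
  lc_scalars (lc_unit R x) = lc_unit S x.
Proof. by apply: lincombP => y /=; rewrite rmorph_nat. Qed.

Lemma lc_scalars_map (X Y : Type) (g : X -> Y) (t : lincomb R X) :
  lc_scalars (lc_map g t) = lc_map g (lc_scalars t).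
Proof.
apply: lincombP => y /=.
rewrite -(infsum_morph fc); last exact/cvg_zero_if/lcoef_cvg0.
by congr infsum; apply/funext => x; case: ifP => // _; rewrite rmorph0.
Qed.

Lemma lc_scalars_join (X : Type) (t : lincomb R (lincomb R X)) :
  lc_scalars (lc_join t) = lc_join (lc_map (@lc_scalars X) (lc_scalars t)).
Proof.
apply: lincombP => x /=.
rewrite -(infsum_morph fc); last exact/cvg_zero_mulr/lcoef_cvg0.
rewrite -[LHS](infsum_fiber (@lc_scalars X)); last first.
  by apply: (cvg_zero_morph fc); exact/cvg_zero_mulr/lcoef_cvg0.
congr infsum; apply/funext => a.
rewrite -infsum_mulr; last first.
  exact/cvg_zero_if/(lcoef_cvg0 (lc_scalars t)).
congr infsum; apply/funext => b; case: asboolP => [<-|_] /=.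
  by rewrite rmorphM.
by rewrite mul0r.
Qed.

Section Object.
Variable Q : contramodule S.

Definition res_pi (t : lincomb R Q) : Q := cm_pi Q (lc_scalars t).

Lemma res_unit p : res_pi (lc_unit R p) = p.
Proof. by rewrite /res_pi lc_scalars_unit cm_unit. Qed.

Lemma res_assoc t : res_pi (lc_map res_pi t) = res_pi (lc_join t).
Proof.
rewrite /res_pi lc_scalars_map lc_scalars_join -cm_assoc -lc_map_comp.
by [].
Qed.

Definition res : contramodule R := Contramodule res_unit res_assoc.

End Object.

Lemma res_hom_subproof (P Q : contramodule S) (h : contra_hom P Q) t :
  h (res_pi t) = res_pi (lc_map h t).
Proof. by rewrite /res_pi contra_homP lc_scalars_map. Qed.

Definition res_hom (P Q : contramodule S) (h : contra_hom P Q) :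
    contra_hom (res P) (res Q) :=
  @ContraHom R (res P) (res Q) h (res_hom_subproof h).

Definition res_fully_faithful (C : contramodule S -> Prop) :=
  forall P Q : contramodule S, C P -> C Q -> bijective (@res_hom P Q).

Lemma res_cm_separated (P : contramodule S) : cm_separated P -> cm_separated (res P).
Proof.
have zE : (0 : res P) = (0 : P) :> P.
  rewrite /GRing.zero /= /cm_zero /= /res_pi; congr cm_pi.
  by apply: lincombP => x /=; rewrite rmorph0.
move=> sP; apply/seteqP; split=> [p pI|p /= ->]; last first.
  by move=> I [[_ I0 _] _]; exists 0.
have : [set 0] (p : P); last by rewrite /= zE.
rewrite -sP => J [oJ Jm].
have [|t tJ <-] := pI (f @^-1` J).
  split; first exact: (open_subgroup_preimage fc).
  by move=> x r /= Jx; rewrite rmorphM; exact: Jm.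
by exists (lc_scalars t).
Qed.

End Restriction.

Section Generated.
Variables (V : zmodType) (G : set V).

Definition generated : {pred V} :=
  [pred v | `[< forall H : zmodClosed V, (forall g, G g -> g \in H) -> v \in H >]].

Lemma generated_closed : zmod_closed generated.
Proof.
split; first by apply/asboolP => H _; exact: rpred0.
move=> x y /asboolP xG /asboolP yG; apply/asboolP => H GH.
by apply: rpredB; [exact: xG|exact: yG].
Qed.

HB.instance Definition _ := GRing.isZmodClosed.Build V generated generated_closed.

Lemma generated_mem v : G v -> v \in generated.
Proof. by move=> Gv; apply/asboolP => H; apply. Qed.

Lemma generated_ker (W : zmodType) (h : {additive V -> W}) :
  (forall g, G g -> h g = 0) -> forall v, v \in generated -> h v = 0.
Proof.
move=> hG v /asboolP.
pose K : {pred V} := [pred v | h v == 0].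
have Kc : zmod_closed K.
  split; first by rewrite inE raddf0.
  by move=> x y; rewrite !inE raddfB => /eqP-> /eqP->; rewrite subrr.
pose KM := GRing.isZmodClosed.Build V K Kc.
pose KZ : zmodClosed V := HB.pack K KM.
by move=> /(_ KZ) h0; apply/eqP; apply: h0 => g /hG /eqP.
Qed.

End Generated.

Section Tensor.
Variables A B : zmodType.

Definition bilinear_relations : set {freeg (A * B)} :=
  [set z | exists a a' b, z = << (a + a', b) >> - << (a, b) >> - << (a', b) >>] `|`
  [set z | exists a b b', z = << (a, b + b') >> - << (a, b) >> - << (a, b') >>].

Definition tensor : zmodType := Quotient.quot (generated bilinear_relations).

Definition tens (a : A) (b : B) : tensor := \pi_tensor << (a, b) >>.

End Tensor.

Section TensorTheory.
Variables A B : zmodType.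
Implicit Types (a : A) (b : B).

Lemma pi_quot0 (V : zmodType) (H : zmodClosed V) :
  \pi_(Quotient.quot H) 0 = 0.
Proof. by rewrite piE. Qed.

Lemma pi_quotD (V : zmodType) (H : zmodClosed V) :
  {morph \pi_(Quotient.quot H) : x y / x + y}.
Proof. by move=> x y; rewrite !piE. Qed.

Lemma pi_quotN (V : zmodType) (H : zmodClosed V) :
  {morph \pi_(Quotient.quot H) : x / - x}.
Proof. by move=> x; rewrite !piE. Qed.

Lemma pi_quot_eq0 (V : zmodType) (H : zmodClosed V) v :
  v \in H -> \pi_(Quotient.quot H) v = 0.
Proof.
move=> vH; apply/eqP.
by rewrite -(pi_quot0 H) -Quotient.idealrBE subr0.
Qed.

Lemma tensDl b : {morph (@tens A B)^~ b : a a' / a + a'}.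
Proof.
move=> a a'; apply/eqP; rewrite -subr_eq0 opprD addrA /tens -!pi_quotN -!pi_quotD.
by apply/eqP/pi_quot_eq0/generated_mem; left; exists a, a', b.
Qed.

Lemma tensDr a : {morph @tens A B a : b b' / b + b'}.
Proof.
move=> b b'; apply/eqP; rewrite -subr_eq0 opprD addrA /tens -!pi_quotN -!pi_quotD.
by apply/eqP/pi_quot_eq0/generated_mem; right; exists a, b, b'.
Qed.

End TensorTheory.

Section FreeLift.
Variables (K : choiceType) (M : zmodType) (h : K -> M).

Definition free_lift (z : {freeg K}) : M := fglift (h : K -> zmodule M) z.

Lemma free_liftE k : free_lift << k >> = h k.
Proof. by rewrite /free_lift liftU scale1r. Qed.

Lemma free_lift_additive : zmod_morphism free_lift.
Proof. exact: (@lift_is_additive _ _ (zmodule M)). Qed.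

HB.instance Definition _ :=
  GRing.isZmodMorphism.Build {freeg K} M free_lift free_lift_additive.

End FreeLift.

Section TensorLift.
Variables (A B M : zmodType) (phi : A -> B -> M).

Definition biadditive :=
  (forall b, {morph phi^~ b : a a' / a + a'}) /\
  (forall a, {morph phi a : b b' / b + b'}).

Definition tens_lift of biadditive := fun z : tensor A B =>
  free_lift (fun p : A * B => phi p.1 p.2) (repr z).

Hypothesis bi : biadditive.

Lemma tens_lift_pi (z : {freeg (A * B)}) :
  tens_lift bi (\pi_(tensor A B) z) = free_lift (fun p => phi p.1 p.2) z.
Proof.
rewrite /tens_lift; apply/eqP; rewrite -subr_eq0 -raddfB; apply/eqP.
apply: (@generated_ker _ (@bilinear_relations A B)).
  move=> g [[a [a' [b ->]]]|[a [b [b' ->]]]].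
    by rewrite !raddfB /= !free_liftE /= bi.1 -addrA -opprD subrr.
  by rewrite !raddfB /= !free_liftE /= bi.2 -addrA -opprD subrr.
by rewrite Quotient.idealrBE reprK.
Qed.

Lemma tens_liftE a b : tens_lift bi (tens a b) = phi a b.
Proof. by rewrite /tens tens_lift_pi free_liftE. Qed.

Lemma tens_lift_additive : zmod_morphism (tens_lift bi).
Proof.
move=> x y; rewrite -[x]reprK -[y]reprK -pi_quotN -pi_quotD !tens_lift_pi.
exact: raddfB.
Qed.

HB.instance Definition _ :=
  GRing.isZmodMorphism.Build (tensor A B) M (tens_lift bi) tens_lift_additive.

Lemma tens_ext (h h' : {additive tensor A B -> M}) :
  (forall a b, h (tens a b) = h' (tens a b)) -> h =1 h'.
Proof.
move=> hh z; rewrite -[z]reprK; move: (repr z) => {}z.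
have piZ k (x : A * B) : \pi_(tensor A B) << k *g x >> = tens x.1 x.2 *~ k.
  have piMn (y : {freeg (A * B)}) n : \pi_(tensor A B) (y *+ n) = \pi_(tensor A B) y *+ n.
    by elim: n => [|n IH]; rewrite ?mulr0n ?pi_quot0 // !mulrS pi_quotD IH.
  have -> : << k *g x >> = << x >> *~ k by rewrite freegU_mulz intz.
  case: x => a b; case: k => n; first exact: piMn.
  by rewrite NegzE !mulrNz pi_quotN; congr (- _); exact: piMn.
rewrite -(freeg_sumE z); elim: (dom z) => [|x s IH].
  by rewrite big_nil pi_quot0 !raddf0.
by rewrite big_cons pi_quotD !raddfD IH piZ !raddfMz hh.
Qed.

End TensorLift.

Section Cokernel.
Variables (U V : zmodType) (d : {additive U -> V}).

Definition image_pred : {pred V} := [pred v | `[< exists x, d x = v >]].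

Lemma image_closed : zmod_closed image_pred.
Proof.
split; first by apply/asboolP; exists 0; rewrite raddf0.
move=> x y /asboolP[u <-] /asboolP[v <-]; apply/asboolP.
by exists (u - v); rewrite raddfB.
Qed.

HB.instance Definition _ := GRing.isZmodClosed.Build V image_pred image_closed.

Definition coker : zmodType := Quotient.quot image_pred.

End Cokernel.

Definition coker_map (U V U' V' : zmodType) (d : {additive U -> V})
  (d' : {additive U' -> V'}) (h : V -> V') (z : coker d) : coker d' :=
  \pi_(coker d') (h (repr z)).

Lemma coker_map_pi (U V U' V' : zmodType) (d : {additive U -> V})
    (d' : {additive U' -> V'}) (h : {additive V -> V'}) (v : V) :
  (forall x, exists x', h (d x) = d' x') ->
  coker_map d' h (\pi_(coker d) v) = \pi_(coker d') (h v).
Proof.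
move=> hd; apply/eqP; rewrite -Quotient.idealrBE -raddfB.
have : repr (\pi_(coker d) v) - v \in image_pred d.
  by rewrite Quotient.idealrBE reprK.
by move=> /asboolP[x <-]; apply/asboolP; have [x' ->] := hd x; exists x'.
Qed.

(* Right R-modules are left modules over the converse ring [R^c], on which
   r acts as right multiplication by r. *)
Definition discrete_rmod (R : crlRingType) (N : lmodType R^c) :=
  forall y : N, open [set r : R | (r : R^c) *: y = 0].

Record discreteMod (R : crlRingType) := DiscreteMod {
  dm_sort :> lmodType R^c ;
  dm_discrete : discrete_rmod dm_sort
}.

Section Contratensor.
Variables (R : crlRingType) (N : discreteMod R) (P : contramodule R).

Definition ract (y : N) (r : R) : N := (r : R^c) *: y.

Lemma ract_finite (y : N) (X : Type) (t : lincomb R X) :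
  finite_set [set x | ract y (t x) <> 0].
Proof.
apply: (lcoef_cvg0 t (U := [set r | ract y r = 0])); split.
- exact: dm_discrete.
- exact: scale0r.
- by move=> r s /= r0 s0; rewrite /ract (@scalerBl R^c) -/(ract y r) -/(ract y s) r0 s0 subr0.
Qed.

Lemma ct_pi_biadditive :
  biadditive (fun (y : N) (t : lincomb R P) => tens y (cm_pi P t)).
Proof.
split=> [t y y'|y t t']; first by rewrite tensDl.
by rewrite cm_piD tensDr.
Qed.

(* The sum has finite support by [ract_finite]. *)
Definition ct_act (y : N) (t : lincomb R P) : tensor N P :=
  \sum_(p \in [set: P]) tens (ract y (t p)) p.

Lemma ct_act_widen (D : set P) (y : N) (t : lincomb R P) :
  [set p | ract y (t p) <> 0] `<=` D ->
  ct_act y t = \sum_(p \in D) tens (ract y (t p)) p.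
Proof.
move=> suppD; apply/esym/fsbig_widen => // p [_ nD] /=.
have -> : ract y (t p) = 0 by apply: contrapT => /suppD.
by apply: (addIr (tens (0 : N) p)); rewrite -tensDl addr0 add0r.
Qed.

Lemma ct_act_biadditive : biadditive ct_act.
Proof.
split=> [t y y'|y t t'].
  pose D := [set p | ract y (t p) <> 0] `|` [set p | ract y' (t p) <> 0].
  have fD : finite_set D by rewrite finite_setU; split; exact: ract_finite.
  rewrite !(@ct_act_widen D) => [|p|p|p /= nz].
  - rewrite -fsbig_split //; apply: eq_fsbigr => p _.
    by rewrite /ract scalerDr tensDl.
  - by right.
  - by left.
  - apply: contrapT => /not_orP[/contrapT y0 /contrapT y0']; apply: nz.
    by rewrite /ract scalerDr -/(ract y _) -/(ract y' _) y0 y0' addr0.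
pose D := [set p | ract y (t p) <> 0] `|` [set p | ract y (t' p) <> 0].
have fD : finite_set D by rewrite finite_setU; split; exact: ract_finite.
rewrite !(@ct_act_widen D) => [|p|p|p /= nz].
- rewrite -fsbig_split //; apply: eq_fsbigr => p _.
  by rewrite /ract (@scalerDl R^c) tensDl.
- by right.
- by left.
- apply: contrapT => /not_orP[/contrapT y0 /contrapT y0']; apply: nz.
  by rewrite /ract (@scalerDl R^c) -/(ract y _) -/(ract y (t' p)) y0 y0' addr0.
Qed.

Definition ct_diff (z : tensor N (lincomb R P)) : tensor N P :=
  tens_lift ct_pi_biadditive z - tens_lift ct_act_biadditive z.

Lemma ct_diff_additive : zmod_morphism ct_diff.
Proof.
move=> x y; rewrite /ct_diff (raddfB (tens_lift ct_pi_biadditive)).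
by rewrite (raddfB (tens_lift ct_act_biadditive)) !opprD !opprK addrACA.
Qed.

HB.instance Definition _ := GRing.isZmodMorphism.Build _ _ ct_diff ct_diff_additive.

Definition contratensor : zmodType := coker ct_diff.

End Contratensor.

Section ContratensorMap.
Variables (R : crlRingType) (N N' : discreteMod R) (P : contramodule R).
Variable g : {linear N -> N'}.

Lemma tens_map_biadditive (B : zmodType) :
  biadditive (fun (y : N) (b : B) => tens (g y) b).
Proof.
split=> [b y y'|y b b']; first by rewrite raddfD tensDl.
by rewrite tensDr.
Qed.

Definition contratensor_map : contratensor N P -> contratensor N' P :=
  coker_map (@ct_diff R N' P) (tens_lift (tens_map_biadditive P)).

Lemma contratensor_mapE (z : tensor N P) :
  contratensor_map (\pi_(contratensor N P) z)
  = \pi_(contratensor N' P) (tens_lift (tens_map_biadditive P) z).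
Proof.
apply: coker_map_pi => x; exists (tens_lift (tens_map_biadditive _) x).
pose h := tens_lift (tens_map_biadditive P).
pose k := tens_lift (tens_map_biadditive (lincomb R P)).
have := @tens_ext N (lincomb R P) (tensor N' P)
  (h \o @ct_diff R N P) (@ct_diff R N' P \o k).
apply => y t; rewrite /= /ct_diff raddfB /h /k !tens_liftE; congr (_ - _).
  exact: tens_liftE.
have suppg : [set p | ract (g y) (t p) <> 0] `<=` [set p | ract y (t p) <> 0].
  by move=> p /= nz y0; apply: nz; rewrite /ract -linearZ -/(ract y _) y0 raddf0.
rewrite (ct_act_widen suppg) (ct_act_widen (@subset_refl _ _)).
rewrite !fsbig_finite; [|exact: ract_finite..].
rewrite raddf_sum; apply: eq_bigr => p _.
by rewrite [LHS]tens_liftE /ract linearZ.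
Qed.

End ContratensorMap.

Definition short_exact (A B C : zmodType) (f : A -> B) (g : B -> C) :=
  [/\ injective f, range f = [set b | g b = 0] & range g = setT].

Definition cm_flat (R : crlRingType) (F : contramodule R) :=
  forall (A B C : discreteMod R) (f : {linear A -> B}) (g : {linear B -> C}),
    short_exact f g ->
    short_exact (@contratensor_map R A B F f) (@contratensor_map R B C F g).

(* Main.v *)
(* Restriction of scalars does not change underlying functions, so it is always
   faithful, and the statement is about which R-linear maps are S-linear.

   (1) => (3): it has a left adjoint, sending F to the cokernel T of the two
   natural maps S[[R[[F]]]] -> S[[F]]. For discrete right S-modules N one has
   N (.)_S T = N (.)_R F, so T is flat when F is. Free S-contramodules are flat; for
   F the restriction of one, the unit F -> T is then an R-linear map between
   restrictions of flat S-contramodules, hence S-linear by (1). Any R-linear map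
   F -> Q into a restriction factors as this unit followed by an S-linear map
   T -> Q, hence is S-linear, and every S-contramodule is a quotient of a free one.

   (2) => (1): with a countable base, flat contramodules are separated. Let F be
   flat, G = R[[F]], and K the kernel of G -> F. For open right ideals J in I, flatness
   applied to the inclusion of I/J into R/J shows that an element of K with coefficients
   in I is congruent modulo I.K to one with coefficients in J. Iterating along a
   decreasing base I_n and summing the resulting series in K gives
   K /\ I_n G = I_n K. If p lies in all I_n F, its lifts in G allow one to correct
   the tautological lift by a convergent series in K, so that the lift itself is in K. *)
Require Import Defs.
From HB Require Import structures.
From mathcomp Require Import all_boot all_algebra finmap.
From mathcomp Require Import boolp classical_sets functions cardinality fsbigop.
From mathcomp Require Import filter topology.
From mathcomp.multinomials Require Import freeg.

Set Implicit Arguments.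
Unset Strict Implicit.
Unset Printing Implicit Defensive.

Import GRing.Theory.
Local Open Scope classical_set_scope.
Local Open Scope ring_scope.
Local Open Scope quotient_scope.

(** * Infinite sums and formal linear combinations *)

Section Infsum.
Variable R : crlRingType.

Lemma cvg_zero_mull (X : Type) (r : X -> R) (c : R) :
  cvg_zero r -> cvg_zero (fun x => c * r x).
Proof. by move=> r0 U oU; apply: (r0 _ (open_subgroup_mull c oU)). Qed.

Lemma infsum_mull (X : Type) (r : X -> R) (c : R) : cvg_zero r ->
  infsum (fun x => c * r x) = c * infsum r.
Proof.
move=> r0; apply: eq_mod_open => U oU; have [_ U0 UB] := oU.
have oUc := open_subgroup_mull c oU.
have [A AP] := cvg_zero_fset r0 oUc.
have /= h := infsum_mod r0 oUc AP.
apply: (subgroup_trans U0 UB (infsum_mod (cvg_zero_mull c r0) oU AP)).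
by apply: (subgroup_sym U0 UB); move: h; rewrite mulrBr mulr_sumr.
Qed.

(** Fibering over [g], each fiber sum has at most one term because [g] is injective, and fibers
    outside its range contribute the zero values of [r]. *)
Lemma infsum_inj (X Y : Type) (g : X -> Y) (r : Y -> R) :
  injective g -> cvg_zero r -> (forall y, (forall x, g x <> y) -> r y = 0) ->
  infsum (fun x => r (g x)) = infsum r.
Proof.
move=> gi r0 rg.
have rg0 : cvg_zero (fun x => r (g x)).
  move=> U oU; apply: (@finite_preimage _ _ [set y | ~ U (r y)] g); last exact: r0.
  by move=> x y _ _; exact: gi.
rewrite -(infsum_fiber g rg0); congr infsum; apply/funext => y.
have [[x gx]|nx] := pselect (exists x, g x = y).
  rewrite (@infsum_single _ _ x) ?asboolT ?gx // => z zx.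
  by rewrite asboolF // -gx => /gi.
rewrite rg; last by move=> x gx; apply: nx; exists x.
rewrite -[RHS](@infsum0 R X); congr infsum; apply/funext => x.
by rewrite asboolF // => gx; apply: nx; exists x.
Qed.

(** Both iterated sums are fiberings of one sum over [X * Y], along the two projections; hence the
    convergence hypothesis on the family of pairs. *)
Lemma infsum_swap (X Y : Type) (r : X -> Y -> R) :
  cvg_zero (fun z : X * Y => r z.1 z.2) ->
  infsum (fun x => infsum (r x)) = infsum (fun y => infsum (r^~ y)).
Proof.
move=> r0.
transitivity (infsum (fun z : X * Y => r z.1 z.2)).
  rewrite -(infsum_fiber (@fst X Y) r0); congr infsum; apply/funext => x.
  rewrite -[RHS](@infsum_inj _ _ (fun y => (x, y))).
  - by congr infsum; apply/funext => y /=; rewrite asboolT.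
  - by move=> y y' [].
  - exact: cvg_zero_if.
  - by move=> [x' y] /= h; rewrite asboolF // => xx; apply: (h y); rewrite xx.
rewrite -(infsum_fiber (@snd X Y) r0); congr infsum; apply/funext => y.
rewrite -[LHS](@infsum_inj _ _ (fun x => (x, y))).
- by congr infsum; apply/funext => x /=; rewrite asboolT.
- by move=> x x' [].
- exact: cvg_zero_if.
- by move=> [x y'] /= h; rewrite asboolF // => yy; apply: (h x); rewrite yy.
Qed.

(** If [t x] lies in an open right ideal, so do all its products; for the finitely many other [x],
    left multiplication by [t x] is continuous. *)
Lemma cvg_zero_pair (X Y : Type) (t : X -> R) (s : X -> Y -> R) :
  cvg_zero t -> (forall x, cvg_zero (s x)) ->
  cvg_zero (fun z : X * Y => t z.1 * s z.1 z.2).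
Proof.
move=> t0 s0 U /open_subgroup_right_ideal[I [oI Im] IU].
apply: (@sub_finite_set _ _ (\bigcup_(x in [set x | ~ I (t x)])
   (pair x @` [set y | ~ I (t x * s x y)]))).
  move=> [x y] /= nU; exists x => /=; first by move=> Ix; exact/nU/IU/Im.
  by exists y => // Ixy; exact/nU/IU.
apply: bigcup_finite; first exact: t0.
move=> x _; apply/finite_image.
exact: (s0 x _ (open_subgroup_mull (t x) oI)).
Qed.

End Infsum.

Section Lincomb.
Variable R : crlRingType.

Lemma lc_mapE (X Y : Type) (g : X -> Y) (t : lincomb R X) (s : Y -> R) :
  infsum (fun y => lc_map g t y * s y) = infsum (fun x => t x * s (g x)).
Proof.
rewrite -[RHS](infsum_fiber g); last exact/cvg_zero_mulr/lcoef_cvg0.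
congr infsum; apply/funext => y /=.
rewrite -infsum_mulr; last exact/cvg_zero_if/lcoef_cvg0.
by congr infsum; apply/funext => x; case: asboolP => [<-|_] //; rewrite mul0r.
Qed.

(** The Kleisli extension of the monad: by [lc_bindE] it multiplies a row vector by a matrix, so the
    monad laws become matrix identities. *)
Definition lc_bind (X Y : Type) (g : X -> lincomb R Y) (t : lincomb R X) :=
  lc_join (lc_map g t).

Lemma lc_bindE (X Y : Type) (g : X -> lincomb R Y) (t : lincomb R X) y :
  lc_bind g t y = infsum (fun x => t x * g x y).
Proof. exact: (lc_mapE g t (fun a => a y)). Qed.

Lemma lc_bind_bind (X Y Z : Type) (g : X -> lincomb R Y)
    (h : Y -> lincomb R Z) (t : lincomb R X) :
  lc_bind h (lc_bind g t) = lc_bind (fun x => lc_bind h (g x)) t.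
Proof.
apply: lincombP => z; rewrite !lc_bindE.
transitivity (infsum (fun y => infsum (fun x => t x * (g x y * h y z)))).
  congr infsum; apply/funext => y; rewrite lc_bindE -infsum_mulr.
    by congr infsum; apply/funext => x; rewrite mulrA.
  exact/cvg_zero_mulr/lcoef_cvg0.
rewrite -(@infsum_swap _ _ _ (fun x y => t x * (g x y * h y z))).
  congr infsum; apply/funext => x; rewrite lc_bindE infsum_mull //.
  exact/cvg_zero_mulr/lcoef_cvg0.
apply: (@cvg_zero_pair _ _ _ (t : X -> R) (fun x y => g x y * h y z)).
  exact: lcoef_cvg0.
by move=> x; exact/cvg_zero_mulr/lcoef_cvg0.
Qed.

Lemma lc_map_id (X : Type) (t : lincomb R X) : lc_map id t = t.
Proof.
apply: lincombP => x /=; rewrite (@infsum_single _ _ x) => [|y /asboolF -> //].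
by rewrite asboolT.
Qed.

Lemma lc_bind_id (X : Type) (t : lincomb R (lincomb R X)) :
  lc_bind id t = lc_join t.
Proof. by rewrite /lc_bind lc_map_id. Qed.

Lemma lc_bind_unitr (X Y : Type) (g : X -> Y) (t : lincomb R X) :
  lc_bind (fun x => lc_unit R (g x)) t = lc_map g t.
Proof.
apply: lincombP => y; rewrite lc_bindE; congr infsum; apply/funext => x /=.
have [gx|gx] := pselect (g x = y).
  by rewrite (asboolT gx) asboolT // mulr1.
by rewrite (asboolF gx) asboolF ?mulr0 // => yg; apply: gx.
Qed.

Lemma cm_pi_bind (P : contramodule R) (X : Type) (g : X -> lincomb R P) t :
  cm_pi P (lc_bind g t) = cm_pi P (lc_map (fun x => cm_pi P (g x)) t).
Proof. by rewrite /lc_bind -cm_assoc -lc_map_comp. Qed.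

Lemma lc_coefD (X : Type) (s t : lincomb R X) x : (s + t) x = s x + t x.
Proof. by []. Qed.

Lemma lc_coefN (X : Type) (s : lincomb R X) x : (- s) x = - s x.
Proof. by []. Qed.

Lemma lc_bindD (X Y : Type) (g h : X -> lincomb R Y) t :
  lc_bind (fun x => g x + h x) t = lc_bind g t + lc_bind h t.
Proof.
apply: lincombP => y; rewrite lc_coefD !lc_bindE.
rewrite -infsumD; [|exact/cvg_zero_mulr/lcoef_cvg0..].
by congr infsum; apply/funext => x; rewrite lc_coefD mulrDr.
Qed.

Lemma cm_pi_mapD (P : contramodule R) (X : Type) (g h : X -> P) t :
  cm_pi P (lc_map (fun x => g x + h x) t)
  = cm_pi P (lc_map g t) + cm_pi P (lc_map h t).
Proof.
rewrite -cm_piD -!(lc_bind_unitr _ t) -lc_bindD cm_pi_bind; congr cm_pi.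
by rewrite lc_bind_unitr.
Qed.

Lemma cm_pi_mapB (P : contramodule R) (X : Type) (g h : X -> P) t :
  cm_pi P (lc_map (fun x => g x - h x) t)
  = cm_pi P (lc_map g t) - cm_pi P (lc_map h t).
Proof.
apply/eqP; rewrite eq_sym subr_eq -cm_pi_mapD; apply/eqP; congr (cm_pi _ (lc_map _ _)).
by apply/funext => x; rewrite subrK.
Qed.

(** * Contramodule homomorphisms and free contramodules *)

Lemma contra_hom_additive (P Q : contramodule R) (h : contra_hom P Q) :
  zmod_morphism h.
Proof.
have hD x y : h (x + y) = h x + h y.
  by rewrite /GRing.add /= /cm_add contra_homP lc_mapD !lc_map_unit.
by move=> x y; apply/eqP; rewrite eq_sym subr_eq -hD subrK.
Qed.

HB.instance Definition _ (P Q : contramodule R) (h : contra_hom P Q) :=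
  GRing.isZmodMorphism.Build P Q h (contra_hom_additive h).

Lemma free_assoc (X : Type) (t : lincomb R (lincomb R (lincomb R X))) :
  lc_join (lc_map (@lc_join R X) t) = lc_join (lc_join t).
Proof.
rewrite -[LHS]/(lc_bind (@lc_join R X) t) -(lc_bind_id (lc_join t)) -(lc_bind_id t).
rewrite lc_bind_bind; congr (lc_bind _ t).
by apply/funext => s; rewrite lc_bind_id.
Qed.

Definition free_cm (X : Type) : contramodule R :=
  Contramodule (@lc_join_unit R X) (@free_assoc X).

(** The addition of [free_cm X] is derived from [cm_pi], that of [lincomb R X] is coefficientwise;
    they must be identified before coefficients can be computed. *)
Lemma free_addE (X : Type) (s t : free_cm X) :
  s + t = (s : lincomb R X) + (t : lincomb R X) :> lincomb R X.
Proof. by rewrite [LHS](lc_joinD (lc_unit R s)) !lc_join_unit. Qed.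

Lemma free_zeroE (X : Type) : (0 : free_cm X) = (0 : lincomb R X) :> lincomb R X.
Proof. by apply: (addrI (0 : lincomb R X)); rewrite -free_addE !addr0. Qed.

Lemma free_oppE (X : Type) (s : free_cm X) :
  - s = - (s : lincomb R X) :> lincomb R X.
Proof.
by apply: (addrI (s : lincomb R X)); rewrite -free_addE !subrr free_zeroE.
Qed.

Lemma free_lift_subproof (X : Type) (P : contramodule R) (g : X -> P)
    (t : lincomb R (free_cm X)) :
  cm_pi P (lc_map g (cm_pi (free_cm X) t))
  = cm_pi P (lc_map (fun s : free_cm X => cm_pi P (lc_map g s)) t).
Proof.
rewrite -(lc_bind_unitr g) /= -lc_bind_id lc_bind_bind cm_pi_bind.
congr (cm_pi _ (lc_map _ _)); apply/funext => s.
by rewrite lc_bind_unitr.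
Qed.

Definition free_hom (X : Type) (P : contramodule R) (g : X -> P) :
    contra_hom (free_cm X) P :=
  @ContraHom R (free_cm X) P _ (free_lift_subproof g).

Lemma free_hom_unit (X : Type) (P : contramodule R) (g : X -> P) x :
  free_hom g (lc_unit R x) = g x.
Proof. by rewrite /= lc_map_unit cm_unit. Qed.

(** [t] is the value of [cm_pi] on its own expansion over the basis vectors. *)
Lemma free_homE (X : Type) (P : contramodule R) (h : contra_hom (free_cm X) P) t :
  h t = cm_pi P (lc_map (fun x => h (lc_unit R x)) t).
Proof.
have {1}-> : t = cm_pi (free_cm X) (lc_map (@lc_unit R X) t) :> free_cm X.
  by rewrite /= -/(lc_bind _ _) lc_bind_unitr lc_map_id.
by rewrite contra_homP -lc_map_comp.
Qed.

Lemma contra_homB_subproof (P Q : contramodule R) (g h : contra_hom P Q) t :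
  g (cm_pi P t) - h (cm_pi P t) = cm_pi Q (lc_map (fun x => g x - h x) t).
Proof. by rewrite cm_pi_mapB !contra_homP. Qed.

Definition contra_hom_sub (P Q : contramodule R) (g h : contra_hom P Q) :
    contra_hom P Q :=
  ContraHom (contra_homB_subproof g h).

Lemma contra_comp_subproof (P Q W : contramodule R) (g : contra_hom Q W)
    (h : contra_hom P Q) t :
  g (h (cm_pi P t)) = cm_pi W (lc_map (fun x => g (h x)) t).
Proof. by rewrite !contra_homP -lc_map_comp. Qed.

Definition contra_comp (P Q W : contramodule R) (g : contra_hom Q W)
    (h : contra_hom P Q) : contra_hom P W :=
  ContraHom (contra_comp_subproof g h).

End Lincomb.

(** * Kernels, cokernels and contratensor products *)

Section MapZero.
Variables (R : crlRingType) (P : contramodule R).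

Lemma cm_pi_map0 (X : Type) (t : lincomb R X) :
  cm_pi P (lc_map (fun=> 0) t) = 0.
Proof.
rewrite -[RHS](subrr (cm_pi P (lc_map (fun=> 0) t))) -cm_pi_mapB.
by congr (cm_pi _ (lc_map _ _)); apply/funext => x; rewrite subrr.
Qed.

End MapZero.

Lemma sval_prop_inj (T : Type) (P : T -> Prop) : injective (@sval T P).
Proof.
move=> [x Px] [y Py] /= xy; case: _ / xy Py => Py.
by congr exist; exact: Prop_irrelevance.
Qed.

Section Kernel.
Variables (R : crlRingType) (P Q : contramodule R) (d : contra_hom P Q).
Local Notation K := {p : P | d p = 0}.

Lemma ker_pi_subproof (t : lincomb R K) : d (cm_pi P (lc_map sval t)) = 0.
Proof.
rewrite contra_homP -lc_map_comp -[RHS](cm_pi_map0 _ t); congr (cm_pi _ (lc_map _ _)).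
by apply/funext => -[].
Qed.

Definition ker_pi (t : lincomb R K) : K := exist _ _ (ker_pi_subproof t).

Lemma ker_unit p : ker_pi (lc_unit R p) = p.
Proof. by apply: sval_prop_inj; rewrite /= lc_map_unit cm_unit. Qed.

Lemma ker_assoc t : ker_pi (lc_map ker_pi t) = ker_pi (lc_join t).
Proof.
apply: sval_prop_inj; rewrite /= -lc_map_comp -(lc_bind_unitr sval (lc_join t)).
rewrite -lc_bind_id lc_bind_bind cm_pi_bind; congr (cm_pi _ (lc_map _ _)).
by apply/funext => s; rewrite /= lc_bind_unitr.
Qed.

Definition ker_cm : contramodule R := Contramodule ker_unit ker_assoc.

Definition ker_incl : contra_hom ker_cm P :=
  @ContraHom R ker_cm P sval (fun=> erefl).

End Kernel.

Section Cokernel.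
Variables (R : crlRingType) (P Q : contramodule R) (d : contra_hom P Q).
Local Notation C := (coker (contra_fun d : {additive P -> Q})).

Lemma coker_eqP (a b : Q) :
  \pi_C a = \pi_C b <-> exists u, d u = a - b.
Proof.
split=> [/eqP|h]; first by rewrite -Quotient.idealrBE => /asboolP.
by apply/eqP; rewrite -Quotient.idealrBE; apply/asboolP.
Qed.

(** The image of [d] is closed under infinite combinations: preimages of all [g x - h x] are chosen
    at once and combined in [P] with the same coefficients. Hence [coker_pi] may use
    representatives. *)
Lemma coker_pi_map (X : Type) (g h : X -> Q) (t : lincomb R X) :
  (forall x, \pi_C (g x) = \pi_C (h x)) ->
  \pi_C (cm_pi Q (lc_map g t)) = \pi_C (cm_pi Q (lc_map h t)).
Proof.
move=> gh; apply/coker_eqP.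
have [u uP] := choice (fun x => (coker_eqP (g x) (h x)).1 (gh x)).
exists (cm_pi P (lc_map u t)); rewrite contra_homP -lc_map_comp -cm_pi_mapB.
by congr (cm_pi _ (lc_map _ _)); apply/funext => x /=.
Qed.

Definition coker_pi (t : lincomb R C) : C := \pi_C (cm_pi Q (lc_map repr t)).

Lemma coker_unit x : coker_pi (lc_unit R x) = x.
Proof. by rewrite /coker_pi lc_map_unit cm_unit reprK. Qed.

Lemma coker_assoc t : coker_pi (lc_map coker_pi t) = coker_pi (lc_join t).
Proof.
rewrite /coker_pi -lc_map_comp.
rewrite (@coker_pi_map _ _ (fun s => cm_pi Q (lc_map repr s))); last first.
  by move=> s /=; rewrite reprK.
rewrite -(lc_bind_unitr repr (lc_join t)) -lc_bind_id lc_bind_bind cm_pi_bind.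
congr (\pi_C (cm_pi _ (lc_map _ _))).
by apply/funext => s; rewrite /= lc_bind_unitr.
Qed.

Definition coker_cm : contramodule R := Contramodule coker_unit coker_assoc.

Lemma coker_proj_subproof t :
  \pi_C (cm_pi Q t) = cm_pi coker_cm (lc_map (fun x => \pi_C x) t).
Proof.
rewrite /= /coker_pi -lc_map_comp -{1}(lc_map_id t).
by apply: coker_pi_map => x /=; rewrite reprK.
Qed.

Definition coker_proj : contra_hom Q coker_cm :=
  @ContraHom R Q coker_cm (fun x => \pi_C x) coker_proj_subproof.

Lemma coker_projK (x : coker_cm) : coker_proj (repr (x : C)) = x.
Proof. exact: reprK. Qed.

Lemma coker_lift_subproof (W : contramodule R) (g : contra_hom Q W) :
  (forall u, g (d u) = 0) ->
  forall t : lincomb R coker_cm,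
  g (repr (cm_pi coker_cm t : C))
  = cm_pi W (lc_map (fun x : coker_cm => g (repr (x : C))) t).
Proof.
move=> gd t; have gpi a b : \pi_C a = \pi_C b -> g a = g b.
  by move=> /coker_eqP[u du]; apply/eqP; rewrite -subr_eq0 -raddfB -du; exact/eqP/gd.
by rewrite (gpi _ (cm_pi Q (lc_map repr t))) ?reprK // contra_homP -lc_map_comp.
Qed.

Definition coker_lift (W : contramodule R) (g : contra_hom Q W)
    (gd : forall u, g (d u) = 0) : contra_hom coker_cm W :=
  ContraHom (coker_lift_subproof gd).

Lemma coker_liftE (W : contramodule R) (g : contra_hom Q W)
    (gd : forall u, g (d u) = 0) x :
  coker_lift gd (coker_proj x) = g x.
Proof.
rewrite /=; apply/eqP; rewrite -subr_eq0 -raddfB.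
by have /coker_eqP[u <-] := reprK (\pi_C x); exact/eqP/gd.
Qed.

End Cokernel.

Section Contratensor.
Variables (R : crlRingType) (N : discreteMod R).

Lemma ract0 (y : N) : ract y 0 = 0. Proof. exact: scale0r. Qed.
Lemma ract0l r : ract (0 : N) r = 0. Proof. exact: scaler0. Qed.
Lemma ract1 (y : N) : ract y 1 = y. Proof. exact: scale1r. Qed.
Lemma ractM (y : N) r s : ract y (r * s) = ract (ract y r) s.
Proof. by rewrite /ract scalerA. Qed.
Lemma ractDr (y : N) : {morph ract y : r s / r + s}.
Proof. by move=> r s; rewrite /ract (@scalerDl R^c). Qed.
Lemma ractDl r : {morph (fun y : N => ract y r) : x y / x + y}.
Proof. by move=> x y; rewrite /ract scalerDr. Qed.
Lemma ractBr (y : N) r s : ract y (r - s) = ract y r - ract y s.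
Proof. by apply/eqP; rewrite eq_sym subr_eq -ractDr subrK. Qed.
Lemma ract_sumr (y : N) (I : Type) (s : seq I) (F : I -> R) :
  ract y (\sum_(i <- s) F i) = \sum_(i <- s) ract y (F i).
Proof. exact: (big_morph _ (ractDr y) (ract0 y)). Qed.

Lemma open_annihilator (y : N) : open_subgroup [set r | ract y r = 0].
Proof.
split; [exact: dm_discrete|exact: ract0|].
by move=> r s /= r0 s0; rewrite ractBr r0 s0 subrr.
Qed.

Lemma ract_fset (X : choiceType) (y : N) (t : lincomb R X) :
  exists A : {fset X}, forall x, x \notin A -> ract y (t x) = 0.
Proof.
exists (fset_set [set x | ract y (t x) <> 0]) => x.
rewrite in_fset_set; last exact: ract_finite.
by move=> /negP h; apply: contrapT => nz; apply: h; rewrite inE.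
Qed.

Lemma ract_infsum (X : choiceType) (y : N) (r : X -> R) (A : {fset X}) :
  cvg_zero r -> (forall x, x \notin A -> ract y (r x) = 0) ->
  ract y (infsum r) = \sum_(x <- A) ract y (r x).
Proof.
(* [infsum_mod] takes its finite sets in [{classic X}], so [A] is carried over along the
   identity. *)
move=> r0 rA; pose B := [fset (id : X -> {classic X}) x | x in A]%fset.
have rB (x : {classic X}) : x \notin B -> ract y (r x) = 0.
  by move=> xB; apply: rA; apply: contra xB => xA; apply/imfsetP; exists x.
have := infsum_mod r0 (open_annihilator y) rB => /= /eqP.
rewrite ractBr subr_eq0 => /eqP ->; rewrite ract_sumr.
by rewrite big_imfset.
Qed.

(** A finite sum whenever [phi] vanishes at zero, since annihilators are open. With [phi] equal to
    [tens] it is the second map defining the contratensor product; general [phi] serve to state the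
    balance condition. *)
Definition act_sum (X : choiceType) (M : zmodType) (phi : N -> X -> M)
    (y : N) (t : lincomb R X) : M :=
  \sum_(x \in [set: X]) phi (ract y (t x)) x.

Lemma act_sumE (X : choiceType) (M : zmodType) (phi : N -> X -> M)
    (phi0 : forall x, phi 0 x = 0) (y : N) (t : lincomb R X) (A : {fset X}) :
  (forall x, x \notin A -> ract y (t x) = 0) ->
  act_sum phi y t = \sum_(x <- A) phi (ract y (t x)) x.
Proof.
move=> tA; rewrite /act_sum (fsbigE A) //=.
  by apply: eq_bigl => x; rewrite in_setT.
by move=> x _ xA; rewrite tA.
Qed.

(** An exchange of two finite sums: over a set [A] supporting [t], and over the union [C] of the
    supports of the [g z] after acting on [ract y (t z)]. *)
Lemma act_sum_bind (X Z : choiceType) (M : zmodType) (phi : N -> X -> M)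
    (phiD : forall x, {morph phi^~ x : y y' / y + y'})
    (y : N) (g : Z -> lincomb R X) (t : lincomb R Z) :
  act_sum phi y (lc_bind g t) = act_sum (fun y z => act_sum phi y (g z)) y t.
Proof.
have phi0 x : phi 0 x = 0 by apply: (addIr (phi 0 x)); rewrite -phiD !add0r.
have [A AP] := ract_fset y t.
have [B BP] := choice (fun z => ract_fset (ract y (t z)) (g z)).
pose C := (\bigcup_(z <- A) B z)%fset.
have BC z : z \in A -> {subset B z <= C}.
  by move=> zA; apply/fsubsetP; exact: bigfcup_sup.
have CP x z : x \notin C -> ract (ract y (t z)) (g z x) = 0.
  move=> xC; have [zA|zA] := boolP (z \in A); last by rewrite AP // ract0l.
  by apply: BP; apply: contra xC; exact: BC.
have bindE x : ract y (lc_bind g t x) = \sum_(z <- A) ract (ract y (t z)) (g z x).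
  rewrite lc_bindE (ract_infsum (A := A)).
  - by apply: eq_bigr => z _; rewrite ractM.
  - exact/cvg_zero_mulr/lcoef_cvg0.
  - by move=> z zA; rewrite ractM AP // ract0l.
rewrite (act_sumE phi0 (A := C)); last first.
  by move=> x xC; rewrite bindE big1 // => z _; exact: CP.
rewrite (act_sumE _ (A := A)) //; last first.
  move=> z; rewrite (act_sumE phi0 (A := fset0)) ?big_seq_fset0 // => x _.
  exact: ract0l.
transitivity (\sum_(x <- C) \sum_(z <- A) phi (ract (ract y (t z)) (g z x)) x).
  apply: eq_bigr => x _; rewrite bindE.
  exact: (big_morph (phi^~ x) (phiD x) (phi0 x)).
rewrite exchange_big /=; apply: eq_bigr => z _.
by rewrite (act_sumE phi0 (A := C)) // => x; exact: CP.
Qed.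

Lemma act_sum_unit (X : choiceType) (M : zmodType) (phi : N -> X -> M)
    (phi0 : forall x, phi 0 x = 0) (y : N) x :
  act_sum phi y (lc_unit R x) = phi y x.
Proof.
rewrite (act_sumE phi0 (A := [fset x]%fset)).
  by rewrite big_seq_fset1 /= asboolT // ract1.
by move=> z; rewrite inE => /eqP zx /=; rewrite asboolF // ract0.
Qed.

Lemma act_sum_map (X Z : choiceType) (M : zmodType) (phi : N -> X -> M)
    (phiD : forall x, {morph phi^~ x : y y' / y + y'})
    (y : N) (g : Z -> X) (t : lincomb R Z) :
  act_sum phi y (lc_map g t) = act_sum (fun y z => phi y (g z)) y t.
Proof.
have phi0 x : phi 0 x = 0 by apply: (addIr (phi 0 x)); rewrite -phiD !add0r.
rewrite -lc_bind_unitr act_sum_bind //; apply: eq_fsbigr => z _.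
exact: act_sum_unit.
Qed.

Lemma act_sum_morph (X : choiceType) (M M' : zmodType) (phi : N -> X -> M)
    (h : {additive M -> M'}) (phi0 : forall x, phi 0 x = 0)
    (y : N) (t : lincomb R X) :
  h (act_sum phi y t) = act_sum (fun y x => h (phi y x)) y t.
Proof.
have [A AP] := ract_fset y t.
rewrite (act_sumE phi0 AP) raddf_sum (act_sumE _ AP) // => x.
by rewrite phi0 raddf0.
Qed.

Lemma act_sum_biadditive (X : choiceType) (M : zmodType) (phi : N -> X -> M)
    (phiD : forall x, {morph phi^~ x : y y' / y + y'}) :
  biadditive (act_sum phi).
Proof.
have phi0 x : phi 0 x = 0 by apply: (addIr (phi 0 x)); rewrite -phiD !add0r.
split=> [t y y'|y t t'].
  have [A AP] := ract_fset y t; have [B BP] := ract_fset y' t.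
  rewrite !(act_sumE phi0 (A := (A `|` B)%fset)) => [|x|x|x].
  - by rewrite -big_split; apply: eq_bigr => x _; rewrite ractDl phiD.
  - by rewrite inE negb_or => /andP[_ /BP].
  - by rewrite inE negb_or => /andP[/AP].
  - by rewrite inE negb_or ractDl => /andP[/AP -> /BP ->]; rewrite addr0.
have [A AP] := ract_fset y t; have [B BP] := ract_fset y t'.
rewrite !(act_sumE phi0 (A := (A `|` B)%fset)) => [|x|x|x].
- by rewrite -big_split; apply: eq_bigr => x _; rewrite lc_coefD ractDr phiD.
- by rewrite inE negb_or => /andP[_ /BP].
- by rewrite inE negb_or => /andP[/AP].
- by rewrite inE negb_or lc_coefD ractDr => /andP[/AP -> /BP ->]; rewrite addr0.
Qed.

End Contratensor.

Section ContratensorUniversal.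
Variables (R : crlRingType) (N : discreteMod R) (P : contramodule R).

Definition ct (y : N) (p : P) : contratensor N P := \pi_(contratensor N P) (tens y p).

Lemma ct_biadditive : biadditive ct.
Proof. by split=> [p|y] a b; rewrite /ct ?tensDl ?tensDr pi_quotD. Qed.

Lemma ctDl p : {morph ct^~ p : y y' / y + y'}. Proof. exact: ct_biadditive.1. Qed.
Lemma ctDr y : {morph ct y : p p' / p + p'}. Proof. exact: ct_biadditive.2. Qed.
Lemma ct0l p : ct 0 p = 0.
Proof. by apply: (addIr (ct 0 p)); rewrite -ctDl !add0r. Qed.
Lemma ct0r y : ct y 0 = 0.
Proof. by apply: (addIr (ct y 0)); rewrite -ctDr !add0r. Qed.

Lemma ct_diff_tens (y : N) (t : lincomb R P) :
  @ct_diff R N P (tens y t) = tens y (cm_pi P t) - act_sum (@tens N P) y t.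
Proof. by rewrite -[LHS]/(tens_lift _ _ - tens_lift _ _) !tens_liftE. Qed.

Lemma ct_cm_pi (y : N) (t : lincomb R P) : ct y (cm_pi P t) = act_sum ct y t.
Proof.
have [A AP] := ract_fset y t.
rewrite (act_sumE ct0l AP).
transitivity (\pi_(contratensor N P) (\sum_(p <- A) tens (ract y (t p)) p)); last first.
  exact: (big_morph _ (@pi_quotD _ _) (@pi_quot0 _ _)).
apply/eqP; rewrite -Quotient.idealrBE; apply/asboolP; exists (@tens N (lincomb R P) y t).
rewrite [LHS]ct_diff_tens; congr (_ - _).
rewrite -[LHS]/(act_sum (@tens N P) y t) (act_sumE _ AP) // => p.
by apply: (addIr (tens (0 : N) p)); rewrite -tensDl !add0r.
Qed.

Lemma ct_cm_pi_map (X : choiceType) (y : N) (g : X -> P) (t : lincomb R X) :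
  ct y (cm_pi P (lc_map g t)) = act_sum (fun y x => ct y (g x)) y t.
Proof. by rewrite ct_cm_pi act_sum_map // => p; exact: ctDl. Qed.

Lemma ct_ind (Pr : contratensor N P -> Prop) :
  Pr 0 -> (forall a b, Pr a -> Pr b -> Pr (a - b)) ->
  (forall y p, Pr (ct y p)) -> forall z, Pr z.
Proof.
move=> Pr0 PrB Prct z.
have PrN a : Pr a -> Pr (- a) by move=> Pa; rewrite -sub0r; exact: PrB.
have PrD a b : Pr a -> Pr b -> Pr (a + b).
  by move=> Pa Pb; rewrite -[b]opprK; exact/PrB/PrN.
pose pr w : contratensor N P := \pi_(contratensor N P) (\pi_(tensor N P) w).
have prD : {morph pr : v w / v + w} by move=> v w; rewrite /pr !pi_quotD.
have pr0 : pr 0 = 0 by rewrite /pr !pi_quot0.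
(* The contratensor product is a quotient of a quotient; two [repr] lead back to the free abelian
   group on pairs, which is generated by single pairs. *)
have -> : z = pr (repr (repr z)) by rewrite /pr !reprK.
move: (repr (repr z)) => {}z; rewrite -(freeg_sumE z).
elim: (dom z) => [|[y p] s IH]; first by rewrite big_nil pr0.
rewrite big_cons prD; apply: (PrD _ _ _ IH) => {IH s}.
rewrite -[coeff _ _]intz -freegU_mulz.
have prn n : Pr (pr (<< (y, p) >> *+ n)).
  elim: n => [|n IH]; first by rewrite mulr0n pr0.
  by rewrite mulrS prD; apply: (PrD _ _ _ IH); exact: Prct.
case: (coeff _ _) => n; first exact: prn.
by rewrite NegzE mulrNz /pr !pi_quotN; exact/PrN/prn.
Qed.

Section Lift.
Variables (M : zmodType) (phi : N -> P -> M).
Hypotheses (bi : biadditive phi)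
  (bal : forall y t, phi y (cm_pi P t) = act_sum phi y t).

(** The universal property: a biadditive map that satisfies the balance identity factors through the
    contratensor product. *)
Definition ct_lift of (forall y t, phi y (cm_pi P t) = act_sum phi y t) :=
  fun z : contratensor N P => tens_lift bi (repr z).

Lemma ct_lift_pi z : ct_lift bal (\pi_(contratensor N P) z) = tens_lift bi z.
Proof.
rewrite /ct_lift; apply/eqP; rewrite -subr_eq0 -raddfB; apply/eqP.
have : repr (\pi_(contratensor N P) z) - z \in image_pred (@ct_diff R N P).
  by rewrite Quotient.idealrBE reprK.
move=> /asboolP[x <-].
have := @tens_ext N (lincomb R P) M (tens_lift bi \o @ct_diff R N P) \0.
apply=> y t; rewrite [LHS](congr1 (tens_lift bi) (ct_diff_tens y t)) raddfB.
apply/eqP; rewrite subr_eq0; apply/eqP.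
rewrite [LHS]tens_liftE bal [RHS]act_sum_morph.
  by apply: eq_fsbigr => p _; rewrite [RHS]tens_liftE.
by move=> p; apply: (addIr (tens (0 : N) p)); rewrite -tensDl !add0r.
Qed.

Lemma ct_liftE y p : ct_lift bal (ct y p) = phi y p.
Proof. by rewrite ct_lift_pi tens_liftE. Qed.

Lemma ct_lift_additive : zmod_morphism (ct_lift bal).
Proof.
move=> x y; rewrite -[x]reprK -[y]reprK -pi_quotN -pi_quotD !ct_lift_pi.
exact: raddfB.
Qed.

HB.instance Definition _ :=
  GRing.isZmodMorphism.Build (contratensor N P) M (ct_lift bal) ct_lift_additive.

End Lift.

Lemma ct_ext (M : zmodType) (h h' : {additive contratensor N P -> M}) :
  (forall y p, h (ct y p) = h' (ct y p)) -> h =1 h'.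
Proof.
move=> hh; apply: ct_ind => //; first by rewrite !raddf0.
by move=> a b ha hb; rewrite !raddfB ha hb.
Qed.

End ContratensorUniversal.

Section ContratensorMap.
Variables (R : crlRingType) (N N' : discreteMod R) (P : contramodule R).
Variable g : {linear N -> N'}.

Lemma contratensor_map_ct (y : N) (p : P) :
  contratensor_map g (ct y p) = ct (g y) p.
Proof. by rewrite /ct contratensor_mapE tens_liftE. Qed.

Lemma contratensor_map_additive : zmod_morphism (@contratensor_map R N N' P g).
Proof.
move=> x y; rewrite -[x]reprK -[y]reprK -pi_quotN -pi_quotD !contratensor_mapE.
by rewrite raddfB pi_quotD pi_quotN.
Qed.

HB.instance Definition _ := GRing.isZmodMorphism.Build (contratensor N P)
  (contratensor N' P) (@contratensor_map R N N' P g) contratensor_map_additive.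

Lemma linear_ract (y : N) (r : R) : g (ract y r) = ract (g y) r.
Proof. exact: linearZ. Qed.

End ContratensorMap.

(** * Flatness of free contramodules and extension of scalars *)

Section FreeFlat.
Variables (R : crlRingType) (X : choiceType).
Local Notation G := (free_cm R X).
Local Notation u := (@lc_unit R X).

Section Coefficient.
Variables (N : discreteMod R) (x : X).

Lemma ct_coef_biadditive : biadditive (fun (y : N) (t : G) => ract y (t x)).
Proof.
by split=> [t y y'|y t t']; [exact: ractDl|rewrite free_addE lc_coefD; exact: ractDr].
Qed.

Lemma ct_coef_balanced (y : N) (t : lincomb R G) :
  ract y (cm_pi G t x) = act_sum (fun (y : N) (s : G) => ract y (s x)) y t.
Proof.
have [A AP] := ract_fset y (t : lincomb R G).
rewrite (act_sumE _ AP) => [|s]; last exact: ract0l.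
rewrite /= (ract_infsum (A := A)).
- by apply: eq_bigr => s _; exact: ractM.
- exact/cvg_zero_mulr/lcoef_cvg0.
- by move=> s sA; rewrite ractM AP // ract0l.
Qed.

(** Coordinate [x] of the isomorphism between N (.) R[[X]] and the direct sum of copies of N indexed
    by X. *)
Definition ct_coef : contratensor N G -> N :=
  ct_lift ct_coef_biadditive ct_coef_balanced.
HB.instance Definition _ := GRing.Additive.on ct_coef.

Lemma ct_coefE y t : ct_coef (ct y t) = ract y (t x).
Proof. exact: ct_liftE. Qed.

End Coefficient.

(** Allowing every [B] that contains [A] lets two elements be expanded over a common finite set. *)
Lemma ct_coef_sum (N : discreteMod R) (z : contratensor N G) :
  exists A : {fset X}, forall B : {fset X}, (A `<=` B)%fset ->
    z = \sum_(x <- B) ct (ct_coef x z) (u x : G).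
Proof.
elim/ct_ind: z => [|z z' [A AP] [A' AP']|y t].
- by exists fset0 => B _; rewrite big1 // => x _; rewrite raddf0 ct0l.
- exists (A `|` A')%fset => B /fsubUsetP[AB A'B].
  rewrite {1}(AP _ AB) {1}(AP' _ A'B) -sumrB; apply: eq_bigr => x _.
  rewrite raddfB; apply/eqP; rewrite subr_eq -ctDl; apply/eqP.
  by rewrite subrK.
- have [A AP] := ract_fset y t; exists A => B /fsubsetP AB.
  have {1}-> : t = cm_pi G (lc_map u t) :> G.
    by rewrite /= -/(lc_bind _ _) lc_bind_unitr lc_map_id.
  rewrite ct_cm_pi_map (act_sumE _ (A := B)).
  + by apply: eq_bigr => x _; rewrite ct_coefE.
  + by move=> x; exact: ct0l.
  + by move=> x xB; apply: AP; apply: contra xB; exact: AB.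
Qed.

Lemma ct_coef_map (N N' : discreteMod R) (g : {linear N -> N'}) x z :
  ct_coef x (contratensor_map g z) = g (@ct_coef N x z).
Proof.
have := @ct_ext R N G N' (@ct_coef N' x \o @contratensor_map R N N' G g)
  (g \o @ct_coef N x).
apply=> y t; rewrite /= [contratensor_map _ _]contratensor_map_ct !ct_coefE.
by rewrite linear_ract.
Qed.

(** Since N (.) R[[X]] is a direct sum of copies of N, exactness is checked, and preimages are
    chosen, one coordinate at a time. *)
Lemma free_flat : cm_flat G.
Proof.
move=> A B C f g [fI fg gS].
have sumE (N N' : discreteMod R) (h : {linear N -> N'}) (a : X -> N) (D : {fset X}) :
    contratensor_map h (\sum_(x <- D) ct (a x) (u x : G))
    = \sum_(x <- D) ct (h (a x)) (u x : G).
  by rewrite raddf_sum; apply: eq_bigr => x _; exact: contratensor_map_ct.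
split.
- move=> z z' zz'; have [D DP] := ct_coef_sum z; have [D' DP'] := ct_coef_sum z'.
  rewrite (DP _ (fsubsetUl D D')) (DP' _ (fsubsetUr D D')); apply: eq_bigr => x _.
  by congr ct; apply: fI; rewrite -!ct_coef_map zz'.
- apply/seteqP; split=> [_ [z _ <-]|z /= gz].
    have := @ct_ext R A G (contratensor C G)
      (@contratensor_map R B C G g \o @contratensor_map R A B G f) \0.
    apply => y t /=; rewrite [contratensor_map f _]contratensor_map_ct.
    rewrite [LHS]contratensor_map_ct (_ : g (f y) = 0) ?ct0l //.
    by have : range f (f y) by []; rewrite fg.
  have [D DP] := ct_coef_sum z.
  have /choice[a aP] : forall x, exists y, f y = ct_coef x z.
    move=> x.
    have : [set b | g b = 0] (ct_coef x z) by rewrite /= -ct_coef_map gz raddf0.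
    by rewrite -fg => -[y _ <-]; exists y.
  exists (\sum_(x <- D) ct (a x) (u x : G)) => //.
  by rewrite sumE [RHS](DP D) //; apply: eq_bigr => x _; rewrite aP.
- apply/seteqP; split=> // z _; have [D DP] := ct_coef_sum z.
  have /choice[b bP] : forall x, exists y, g y = ct_coef x z.
    move=> x.
    have : [set: C] (ct_coef x z) by [].
    by rewrite -gS => -[y _ <-]; exists y.
  exists (\sum_(x <- D) ct (b x) (u x : G)) => //.
  by rewrite sumE [RHS](DP D) //; apply: eq_bigr => x _; rewrite bP.
Qed.

End FreeFlat.

Lemma short_exact_iso (A B C A' B' C' : zmodType) (f : A -> B) (g : B -> C)
    (f' : A' -> B') (g' : B' -> C') (a : A -> A') (b : B -> B') (c : C -> C') :
  bijective a -> bijective b -> bijective c -> c 0 = 0 ->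
  (forall x, f' (a x) = b (f x)) -> (forall x, g' (b x) = c (g x)) ->
  short_exact f g -> short_exact f' g'.
Proof.
move=> [a' aK a'K] [b' bK b'K] [c' cK c'K] c0 fab gbc [fI fg gS]; split.
- move=> x y; rewrite -[x]a'K -[y]a'K !fab => /(can_inj bK) /fI ->.
  by [].
- apply/seteqP; split=> [_ [x _ <-]|y /= gy].
    rewrite -[x]a'K fab /= gbc (_ : g _ = 0) //.
    by have : range f (f (a' x)) by []; rewrite fg.
  have : [set b | g b = 0] (b' y).
    by apply: (can_inj cK); rewrite /= -gbc b'K gy.
  by rewrite -fg => -[x _ fx]; exists (a x) => //; rewrite fab fx b'K.
- apply/seteqP; split=> // z _; have : [set: C] (c' z) by [].
  by rewrite -gS => -[y _ gy]; exists (b y) => //; rewrite gbc gy c'K.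
Qed.

(** * Restriction of scalars for discrete right modules *)

Section ModuleRestriction.
Variables (R S : crlRingType) (f : {rmorphism R -> S}) (fc : continuous f).

Section Object.
Variable N : discreteMod S.

(** The alias remembers [f], because the same group carries one right R-module structure for each
    [f]. *)
Definition rmod_res of {rmorphism R -> S} : Type := dm_sort N.
Local Notation M := (rmod_res f).
HB.instance Definition _ := GRing.Zmodule.copy M (dm_sort N).

Definition rmod_scale (r : R^c) (y : M) : M := ract (y : N) (f r).

Lemma rmod_scaleA r s y : rmod_scale r (rmod_scale s y) = rmod_scale (r * s) y.
Proof. by rewrite /rmod_scale -ractM -rmorphM. Qed.

Lemma rmod_scale1 : left_id 1 rmod_scale.
Proof. by move=> y; rewrite /rmod_scale rmorph1 ract1. Qed.

Lemma rmod_scaleDr : right_distributive rmod_scale +%R.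
Proof. by move=> r x y; exact: ractDl. Qed.

Lemma rmod_scaleDl y : {morph rmod_scale^~ y : r s / r + s}.
Proof. by move=> r s; rewrite /rmod_scale rmorphD ractDr. Qed.

HB.instance Definition _ := GRing.Zmodule_isLmodule.Build R^c M
  rmod_scaleA rmod_scale1 rmod_scaleDr rmod_scaleDl.

Lemma rmod_res_discrete : @discrete_rmod R M.
Proof.
move=> y; have [/= o _ _] := open_subgroup_preimage fc (open_annihilator (y : N)).
exact: o.
Qed.

Definition dm_res : discreteMod R := DiscreteMod rmod_res_discrete.

End Object.

Variables (N N' : discreteMod S) (g : {linear N -> N'}).

Definition dm_res_map : dm_res N -> dm_res N' := g.

Lemma dm_res_map_additive : zmod_morphism dm_res_map.
Proof. by move=> x y; exact: (raddfB g). Qed.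

Lemma dm_res_map_scalable : scalable dm_res_map.
Proof. by move=> r y; exact: (linear_ract g (y : N) (f r)). Qed.

HB.instance Definition _ :=
  GRing.isZmodMorphism.Build (dm_res N) (dm_res N') dm_res_map dm_res_map_additive.
HB.instance Definition _ :=
  GRing.isScalable.Build R^c (dm_res N) (dm_res N') _ dm_res_map dm_res_map_scalable.

End ModuleRestriction.
Arguments dm_res_map {R S f} fc {N N'} g.

Lemma res_addE (R S : crlRingType) (f : {rmorphism R -> S}) (fc : continuous f)
    (Q : contramodule S) (x y : res fc Q) : x + y = (x : Q) + (y : Q) :> Q.
Proof.
rewrite -[LHS]/(cm_pi Q (lc_scalars fc (lc_unit R (x : Q) + lc_unit R (y : Q)))).
rewrite -[RHS]/(cm_pi Q (lc_unit S (x : Q) + lc_unit S (y : Q))).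
by congr cm_pi; apply: lincombP => z; rewrite /= rmorphD !rmorph_nat.
Qed.

(** * Extension of scalars, left adjoint to restriction *)

Section Extension.
Variables (R S : crlRingType) (f : {rmorphism R -> S}) (fc : continuous f).
Variable F : contramodule R.
Local Notation G := (free_cm S F).

(** Its values on basis vectors are the relations that turn sending p to the class of 1 p into a
    homomorphism of R-contramodules. *)
Definition ext_rel : contra_hom (free_cm S (lincomb R F)) G :=
  contra_hom_sub (free_hom (fun t : lincomb R F => lc_unit S (cm_pi F t) : G))
                 (free_hom (fun t : lincomb R F => lc_scalars fc t : G)).

Lemma ext_rel_unit (t : lincomb R F) :
  ext_rel (lc_unit S t) = (lc_unit S (cm_pi F t) : G) - (lc_scalars fc t : G).
Proof.
rewrite -[LHS]/(free_hom _ (lc_unit S t) - free_hom _ (lc_unit S t)).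
by rewrite !free_hom_unit.
Qed.

Local Notation ext_coker := (coker (contra_fun ext_rel : {additive _ -> G})).

Definition ext : contramodule S := coker_cm ext_rel.

Definition ext_proj : contra_hom G ext := coker_proj ext_rel.

Lemma ext_unit_subproof t :
  ext_proj (lc_unit S (cm_pi F t))
  = cm_pi (res fc ext) (lc_map (fun p => ext_proj (lc_unit S p)) t).
Proof.
rewrite /= /res_pi lc_scalars_map -[RHS](free_homE ext_proj).
apply/coker_eqP; exists (lc_unit S t).
exact: ext_rel_unit.
Qed.

Definition ext_unit : contra_hom F (res fc ext) :=
  @ContraHom R F (res fc ext) _ ext_unit_subproof.

Lemma ext_proj_sum (s : G) :
  ext_proj s = cm_pi ext (lc_map (fun p => ext_unit p : ext) s).
Proof. exact: (free_homE ext_proj). Qed.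

Section Lift.
Variables (Q : contramodule S) (g : contra_hom F (res fc Q)).

Lemma ext_lift_subproof u : free_hom (g : F -> Q) (ext_rel u) = 0.
Proof.
have gE t : free_hom (g : F -> Q) (ext_rel (lc_unit S t)) = 0.
  rewrite ext_rel_unit [LHS]raddfB [X in X - _]free_hom_unit contra_homP.
  by rewrite [X in X - _]/= /res_pi lc_scalars_map [LHS]subrr.
transitivity (contra_comp (free_hom (g : F -> Q)) ext_rel u) => //.
rewrite free_homE -[RHS](cm_pi_map0 Q u); congr (cm_pi _ (lc_map _ _)).
by apply/funext => t; exact: gE.
Qed.

Definition ext_lift : contra_hom ext Q := coker_lift ext_lift_subproof.

Lemma ext_liftE p : ext_lift (ext_unit p : ext) = g p.
Proof. by rewrite [LHS]coker_liftE free_hom_unit. Qed.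

End Lift.

Section Comparison.
Variable N : discreteMod S.
Local Notation NR := (dm_res fc N).

Lemma res_act_sum (X : choiceType) (M : zmodType) (phi : N -> X -> M) (y : N)
    (t : lincomb R X) :
  act_sum phi y (lc_scalars fc t) = @act_sum R NR X M phi y t.
Proof. by []. Qed.

Lemma ext_to_biadditive :
  biadditive (fun (y : NR) (p : F) => @ct S N ext y (ext_unit p)).
Proof.
split=> [p y y'|y p p']; first exact: ctDl.
by rewrite -ctDr; congr ct; rewrite (raddfD ext_unit) res_addE.
Qed.

Lemma ext_to_balanced (y : NR) (t : lincomb R F) :
  @ct S N ext y (ext_unit (cm_pi F t))
  = act_sum (fun (y : NR) (p : F) => @ct S N ext y (ext_unit p)) y t.
Proof.
rewrite contra_homP -[cm_pi _ _]/(cm_pi ext (lc_scalars fc (lc_map ext_unit t))).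
rewrite lc_scalars_map ct_cm_pi_map.
exact: (res_act_sum (fun y p => @ct S N ext y (ext_unit p))).
Qed.

Definition ext_to : contratensor NR F -> contratensor N ext :=
  ct_lift ext_to_biadditive ext_to_balanced.
HB.instance Definition _ := GRing.Additive.on ext_to.

Lemma ext_toE (y : NR) (p : F) : ext_to (ct y p) = @ct S N ext y (ext_unit p).
Proof. exact: ct_liftE. Qed.

Definition ext_sum (y : N) (s : G) : contratensor NR F :=
  act_sum (fun (y : N) p => @ct R NR F y p) y s.

Lemma ext_sum_biadditive : biadditive ext_sum.
Proof.
have [a b] := @act_sum_biadditive S N F _ (fun y p => @ct R NR F y p) (@ctDl R NR F).
by split=> // y s s'; rewrite /ext_sum free_addE; exact: b.
Qed.

(** It suffices to treat basis vectors, where the claim is the balance relation [ct_cm_pi] over R.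
    Hence [ext_sum] descends to the cokernel [ext]. *)
Lemma ext_sum_rel y u : ext_sum y (ext_rel u) = 0.
Proof.
have bi := ext_sum_biadditive.
have ext_sum0 s : ext_sum 0 s = 0.
  by apply: (addIr (ext_sum 0 s)); rewrite -bi.1 !add0r.
have ext_sumB z s s' : ext_sum z (s - s') = ext_sum z s - ext_sum z s'.
  by apply/eqP; rewrite eq_sym subr_eq -bi.2 subrK.
rewrite (free_homE ext_rel) /= -/(lc_bind _ _) /ext_sum act_sum_bind; last first.
  exact: (@ctDl R NR F).
rewrite /act_sum fsbig1 // => t _; set z := ract y _.
rewrite -[LHS]/(ext_sum z (ext_rel (lc_unit S t))).
rewrite ext_rel_unit ext_sumB /ext_sum act_sum_unit; last exact: (@ct0l R NR F).
by rewrite ct_cm_pi res_act_sum subrr.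
Qed.

Definition ext_of_fun (y : N) (x : ext) : contratensor NR F :=
  ext_sum y (repr (x : ext_coker)).

Lemma ext_of_fun_proj y s : ext_of_fun y (ext_proj s) = ext_sum y s.
Proof.
have bi := ext_sum_biadditive.
rewrite /ext_of_fun; set s' := repr _.
have /coker_eqP[v vE] : ext_proj s' = ext_proj s by exact: coker_projK.
have -> : s' = ext_rel v + s by rewrite vE subrK.
by rewrite bi.2 ext_sum_rel add0r.
Qed.

Lemma ext_projP (x : ext) : exists s, x = ext_proj s.
Proof. by exists (repr (x : ext_coker)); rewrite coker_projK. Qed.

Lemma ext_of_biadditive : biadditive ext_of_fun.
Proof.
have bi := ext_sum_biadditive; split=> [x y y'|y x x'].
  by rewrite /ext_of_fun bi.1.
have [s ->] := ext_projP x; have [s' ->] := ext_projP x'.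
by rewrite -raddfD !ext_of_fun_proj bi.2.
Qed.

Lemma ext_of_balanced (y : N) (t : lincomb S ext) :
  ext_of_fun y (cm_pi ext t) = act_sum ext_of_fun y t.
Proof.
rewrite -[cm_pi ext t]/(ext_proj (lc_join (lc_map repr t))) ext_of_fun_proj.
exact: (@act_sum_bind S N F ext _ _ (@ctDl R NR F) y
  (fun x : ext => repr (x : ext_coker)) t).
Qed.

Definition ext_of : contratensor N ext -> contratensor NR F :=
  ct_lift ext_of_biadditive ext_of_balanced.
HB.instance Definition _ := GRing.Additive.on ext_of.

Lemma ext_ofE (y : N) (s : G) : ext_of (@ct S N ext y (ext_proj s)) = ext_sum y s.
Proof. by rewrite [LHS]ct_liftE ext_of_fun_proj. Qed.

(** The inverse sends the tensor of y with the class of a combination s to the finite sum of the (y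
    s_p) (.) p; both composites are compared on pure tensors. *)
Lemma ext_to_bij : bijective ext_to.
Proof.
exists ext_of.
  have := @ct_ext R NR F _ (ext_of \o ext_to) idfun.
  apply=> y p; rewrite [LHS](congr1 ext_of (ext_toE y p)) [LHS]ext_ofE /ext_sum.
  by rewrite act_sum_unit //; exact: (@ct0l R NR F).
have := @ct_ext S N ext _ (ext_to \o ext_of) idfun.
apply=> y x; have [s ->] := ext_projP x.
rewrite [LHS](congr1 ext_to (ext_ofE y s)) /ext_sum act_sum_morph; last first.
  exact: (@ct0l R NR F).
rewrite -[RHS]/(@ct S N ext y (ext_proj s)) ext_proj_sum ct_cm_pi_map.
apply: eq_fsbigr => p _.
exact: ext_toE.
Qed.

End Comparison.

Lemma ext_to_natural (N N' : discreteMod S) (g : {linear N -> N'}) z :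
  contratensor_map g (@ext_to N z) = ext_to (contratensor_map (dm_res_map fc g) z).
Proof.
have := @ct_ext R (dm_res fc N) F _ (@contratensor_map S N N' ext g \o @ext_to N)
  (@ext_to N' \o @contratensor_map R (dm_res fc N) (dm_res fc N') F (dm_res_map fc g)).
apply=> y p; rewrite [LHS](congr1 (contratensor_map g) (ext_toE y p)).
rewrite [RHS](congr1 (@ext_to N') (contratensor_map_ct (dm_res_map fc g) y p)).
by rewrite [RHS]ext_toE [LHS]contratensor_map_ct.
Qed.

(** Restricting a short exact sequence of discrete modules changes none of its maps, so it stays
    exact; flatness of [F] over R is then transported along the natural isomorphism [ext_to]. *)
Lemma ext_flat : cm_flat F -> cm_flat ext.
Proof.
move=> flatF A B C g h gh.
have := flatF _ _ _ (dm_res_map fc g) (dm_res_map fc h) gh.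
apply: (@short_exact_iso _ _ _ _ _ _ _ _ _ _ (@ext_to A) (@ext_to B) (@ext_to C)).
- exact: ext_to_bij.
- exact: ext_to_bij.
- exact: ext_to_bij.
- exact: raddf0.
- by move=> x; exact: ext_to_natural.
- by move=> x; exact: ext_to_natural.
Qed.

End Extension.

Lemma contra_hom_inj (R : crlRingType) (P Q : contramodule R) (g h : contra_hom P Q) :
  (forall p, g p = h p) -> g = h.
Proof.
case: g h => g gP [h hP] /= /funext gh; case: _ / gh hP => hP.
by congr ContraHom; exact: Prop_irrelevance.
Qed.

(** * From flat contramodules to all contramodules *)

Section FullyFaithful.
Variables (R S : crlRingType) (f : {rmorphism R -> S}) (fc : continuous f).

(** Homomorphisms are equal when their functions are, so restriction is injective on them and only
    fullness remains. *)
Lemma res_fully_faithfulP (C : contramodule S -> Prop) :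
  res_fully_faithful fc C <->
  forall P Q : contramodule S, C P -> C Q ->
    forall h : contra_hom (res fc P) (res fc Q),
    exists g : contra_hom P Q, forall p, g p = h p.
Proof.
split=> [ff P Q CP CQ h|full P Q CP CQ].
  by have [k _ kK] := ff P Q CP CQ; exists (k h) => p; rewrite -[in RHS](kK h).
have [k kP] := choice (full P Q CP CQ).
by exists k => g; apply: contra_hom_inj => p; rewrite ?kP.
Qed.

Lemma res_full_flat
    (f_flat : forall F : contramodule S, cm_flat F -> cm_flat (res fc F)) :
  res_fully_faithful fc (fun P => cm_flat P) ->
  res_fully_faithful fc (fun _ => True).
Proof.
move=> /res_fully_faithfulP ff; apply/res_fully_faithfulP => P Q _ _ h.
pose F := free_cm S P; pose T := ext fc (res fc F).
have flatF : cm_flat F by exact: free_flat.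
(* Both sides are flat over S, so the hypothesis makes the adjunction unit S-linear. *)
have [eta etaE] := ff F T flatF (ext_flat fc (f_flat _ flatF)) (ext_unit fc (res fc F)).
pose q : contra_hom F P := free_hom id.
pose hq := contra_comp h (res_hom fc q).
have hqS t : h (q (cm_pi F t)) = cm_pi Q (lc_map (fun s => h (q s)) t).
  (* As a function, [h] after [q] is the S-linear extension [ext_lift hq] after the S-linear
     [eta]. *)
  have e s : h (q s) = contra_comp (ext_lift hq) eta s.
    by rewrite /= etaE -[RHS]/(ext_lift hq (ext_unit fc (res fc F) s)) ext_liftE.
  rewrite [LHS]e [LHS]contra_homP; congr (cm_pi Q (lc_map _ t)).
  by apply/funext => s; rewrite [RHS]e.
have hS t : h (cm_pi P t) = cm_pi Q (lc_map h t).
  (* Every combination over [P] is lifted along [q] through basis vectors, so S-linearity descends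
     from [h] after [q] to [h]. *)
  have := hqS (lc_map (@lc_unit S P) t).
  rewrite contra_homP -!lc_map_comp /=.
  have qu (p : P) : q (lc_unit S p) = p by rewrite free_hom_unit.
  have -> : q \o lc_unit S (X:=P) = id by apply/funext => p; exact: qu.
  rewrite lc_map_id => ->; congr (cm_pi _ (lc_map _ _)).
  by apply/funext => p; congr (h _); exact: qu.
by exists (ContraHom hS).
Qed.

End FullyFaithful.

(** * Flat contramodules are separated *)

Definition decreasing_base (R : topPzRingType) (I : nat -> set R) :=
  [/\ forall n, open_right_ideal (I n), forall n, I n.+1 `<=` I n &
      forall U, open_subgroup U -> exists n, I n `<=` U].

Lemma decreasing_base_exists (R : crlRingType) :
  countable_base0 R -> exists I : nat -> set R, decreasing_base I.
Proof.
move=> [B cB nE]; have /countable_injP[e eI] := cB.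
(* [b] enumerates [B] through the injection [e]; the whole ring is the default at numbers that [e]
   does not reach. *)
pose b n := xget setT [set A | B A /\ e A = n].
have nb n : nbhs (0 : R) (b n).
  rewrite /b; case: xgetP => [A _ [BA _]|_]; last exact: filterT.
  by rewrite nE; exists A.
have beE A : B A -> b (e A) = A.
  move=> BA; rewrite /b; case: xgetP => [A' _ [BA' eA]|/(_ A)]; last by case.
  by apply: eI; rewrite ?inE.
have /choice[c cP] : forall A : set R, exists I,
    nbhs (0 : R) A -> open_right_ideal I /\ I `<=` A.
  move=> A; have [/right_linearP[I oI IA]|nA] := pselect (nbhs (0 : R) A).
    by exists I.
  by exists set0.
pose I := fix I n := if n is n'.+1 then c (I n' `&` b n) else c (b 0%N).
have In n : open_right_ideal (I n) /\ I n `<=` b n.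
  elim: n => [|n [[[oI I0 _] _] _]]; first exact: cP.
  have [] := cP (I n `&` b n.+1).
    by apply: filterI => //; exact: open_nbhs_nbhs.
  by move=> oJ JI; split=> // x /JI[].
exists I; split=> [n|n|U oU]; first by have [] := In n.
  have [|_ h] := cP (I n `&` b n.+1); last by move=> x /h[].
  by apply: filterI => //; have [[[oI I0 _] _] _] := In n; exact: open_nbhs_nbhs.
have : nbhs (0 : R) U by case: oU => oU U0 _; exact: open_nbhs_nbhs.
rewrite nE => -[A BA AU]; exists (e A) => x Ix; apply: AU.
by rewrite -(beE _ BA); exact: (In _).2.
Qed.

Lemma decreasing_base_le (R : topPzRingType) (I : nat -> set R) m n :
  decreasing_base I -> (m <= n)%N -> I n `<=` I m.
Proof.
move=> [_ dec _] /subnK <-; elim: (n - m)%N => [|k IH] //.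
by rewrite addSn => x /dec; exact: IH.
Qed.

(** Carries to every I_m what [flat_pure] proves for the first member of a base. *)
Lemma decreasing_base_shift (R : topPzRingType) (I : nat -> set R) m :
  decreasing_base I -> decreasing_base (fun n => I (m + n)%N).
Proof.
move=> dI; have [oI dec sub] := dI; split=> [n|n|U /sub[n nU]] //.
  by rewrite addnS; exact: dec.
by exists n => x Ix; apply/nU/(decreasing_base_le dI _ Ix)/leq_addl.
Qed.

Lemma decreasing_base_eq0 (R : crlRingType) (I : nat -> set R) (r : R) :
  decreasing_base I -> (forall n, I n r) -> r = 0.
Proof.
by move=> [_ _ sub] Ir; apply: eq_mod_open => U /sub[n]; rewrite subr0; exact.
Qed.

Section IdealAct.
Variables (R : crlRingType) (I : set R) (oI : open_right_ideal I).
Variable P : contramodule R.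

Lemma ideal_act0 : ideal_act I P 0.
Proof. by exists 0 => // p; have [[_ I0 _] _] := oI. Qed.

Lemma ideal_actB p q : ideal_act I P p -> ideal_act I P q -> ideal_act I P (p - q).
Proof.
move=> [s sI <-] [t tI <-]; exists (s - t) => [x|].
  by have [[_ _ IB] _] := oI; exact: IB.
by apply/eqP; rewrite eq_sym subr_eq -cm_piD subrK.
Qed.

Lemma ideal_act_hom (Q : contramodule R) (h : contra_hom P Q) p :
  ideal_act I P p -> ideal_act I Q (h p).
Proof.
move=> [t tI <-]; exists (lc_map h t); last by rewrite contra_homP.
move=> q /=; have [[_ I0 _] _] := oI; apply: infsum_open; last by move=> x; case: ifP.
  exact/cvg_zero_if/lcoef_cvg0.
by case: oI.
Qed.

(** Each coefficient is an infinite sum of terms t_a a_x with t_a in the right ideal [I], and an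
    open subgroup is closed under convergent sums. *)
Lemma ideal_act_free (X : Type) (s : free_cm R X) :
  ideal_act I (free_cm R X) s -> forall x, I ((s : lincomb R X) x).
Proof.
move=> [t tI <-] x /=; have [osI Im] := oI; apply: infsum_open => //.
  exact/cvg_zero_mulr/lcoef_cvg0.
by move=> a; exact: Im.
Qed.

End IdealAct.

(* Contramodules are complete: sums converge as soon as the n-th term lies in the
   n-th member of a base. The coefficients of all terms form a single family
   over [nat * P]. *)
Lemma contramodule_series (R : crlRingType) (I : nat -> set R) (P : contramodule R)
    (z : nat -> P) :
  decreasing_base I -> (forall n, ideal_act (I n) P (z n)) ->
  exists y, forall n, ideal_act (I n) P (y - \sum_(i < n) z i).
Proof.
move=> dI zI; have [oI _ sub] := dI.
have /choice[t tP] n : exists t : lincomb R P, (forall p, I n (t p)) /\ cm_pi P t = z n.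
  by have [t tI tz] := zI n; exists t.
(* This family is the tail from row [n] on. If I_m lies in [U], only rows below [m] can leave [U],
   each at finitely many places. *)
have T0 n : cvg_zero (fun x : nat * P => if (n <= x.1)%N then t x.1 x.2 else 0).
  move=> U oU; have [m mU] := sub _ oU; have [_ U0 _] := oU.
  apply: (@sub_finite_set _ _ (\bigcup_(i in `I_m) (pair i @` [set p | ~ U (t i p)]))).
    move=> [i p] /=; case: leqP => // _ nU; exists i; last by exists p.
    rewrite /= ltnNge; apply/negP => mi; apply/nU/mU.
    by apply: (decreasing_base_le dI mi); exact: (tP i).1.
  apply: bigcup_finite; first exact: finite_II.
  by move=> i _; apply/finite_image/(lcoef_cvg0 (t i)).
pose T n : lincomb R (nat * P) := LinComb (T0 n).
have TS n : T n = T n.+1 + lc_map (pair n) (t n).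
  apply: lincombP => -[i p] /=; have [ni|ni] := eqVneq n i.
    rewrite -ni leqnn ltnn add0r (@infsum_single _ _ p) ?asboolT // => q qp.
    by rewrite asboolF // => -[].
  rewrite [X in _ + X](_ : _ = 0) ?addr0 ?(ltn_neqAle n i) ?ni //=.
  rewrite -[RHS](@infsum0 R P); congr infsum; apply/funext => q.
  by rewrite asboolF // => -[] /eqP; rewrite (negbTE ni).
(* The sum of all terms of index at least [n]; by [TS] it is the remainder after the first [n]
   terms. *)
pose y n := cm_pi P (lc_map snd (T n)).
have yE n : y 0%N - \sum_(i < n) z i = y n.
  elim: n => [|n IH]; first by rewrite big_ord0 subr0.
  rewrite big_ord_recr /= opprD addrA IH /y TS lc_mapD cm_piD -lc_map_comp.
  by rewrite (_ : snd \o pair n = id) // lc_map_id (tP n).2 addrK.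
exists (y 0%N) => n; rewrite yE; exists (lc_map snd (T n)) => // p /=.
have [[opI I0 IB] _] := oI n; apply: infsum_open => //.
  exact: (cvg_zero_if (fun x : nat * P => `[< x.2 = p >]) (lcoef_cvg0 (T n))).
move=> [i q] /=; case: ifP => // _; case: leqP => // ni.
by apply: (decreasing_base_le dI ni); exact: (tP i).1.
Qed.

(** * The discrete modules R/I and the kernels of maps between discrete modules *)

Section RightQuotient.
Variables (R : crlRingType) (I : set R) (oI : open_right_ideal I).

Definition ideal_pred of open_right_ideal I : {pred R} := [pred r | `[< I r >]].

Lemma ideal_predP r : reflect (I r) (r \in ideal_pred oI).
Proof. exact: asboolP. Qed.

Lemma ideal_pred_closed : zmod_closed (ideal_pred oI).
Proof.
have [[_ I0 IB] _] := oI; split; first exact/ideal_predP.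
by move=> x y /ideal_predP Ix /ideal_predP Iy; exact/ideal_predP/IB.
Qed.

HB.instance Definition _ := GRing.isZmodClosed.Build R (ideal_pred oI) ideal_pred_closed.

Definition rquot : Type := Quotient.quot (ideal_pred oI).
HB.instance Definition _ := GRing.Zmodule.on rquot.

Definition rpi (r : R) : rquot := \pi_(Quotient.quot (ideal_pred oI)) r.
Definition rrepr (x : rquot) : R := repr (x : Quotient.quot (ideal_pred oI)).

Lemma rreprK x : rpi (rrepr x) = x. Proof. exact: reprK. Qed.

Lemma rpi_eq r s : rpi r = rpi s <-> I (r - s).
Proof.
split=> [/eqP|h]; first by rewrite -Quotient.idealrBE => /ideal_predP.
by apply/eqP; rewrite -Quotient.idealrBE; exact/ideal_predP.
Qed.

Lemma rpiD : {morph rpi : r s / r + s}. Proof. exact: pi_quotD. Qed.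
Lemma rpi0 : rpi 0 = 0. Proof. exact: pi_quot0. Qed.
Lemma rpi_eq0 r : rpi r = 0 <-> I r.
Proof. by rewrite -rpi0 rpi_eq subr0. Qed.

Definition rquot_scale (r : R^c) (x : rquot) : rquot := rpi (rrepr x * (r : R)).

Lemma rquot_scale_pi (r : R) (s : R) : rquot_scale r (rpi s) = rpi (s * r).
Proof.
have [_ Im] := oI; apply/rpi_eq; rewrite -mulrBl; apply: Im.
exact/rpi_eq/rreprK.
Qed.

Lemma rquot_scaleA r s x : rquot_scale r (rquot_scale s x) = rquot_scale (r * s) x.
Proof. by rewrite -[x]rreprK !rquot_scale_pi -mulrA. Qed.

Lemma rquot_scale1 : left_id 1 rquot_scale.
Proof. by move=> x; rewrite -[x]rreprK [LHS]rquot_scale_pi mulr1. Qed.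

Lemma rquot_scaleDr : right_distributive rquot_scale +%R.
Proof.
move=> r x y; rewrite -[x]rreprK -[y]rreprK -rpiD !rquot_scale_pi -rpiD.
by rewrite mulrDl.
Qed.

Lemma rquot_scaleDl x : {morph rquot_scale^~ x : r s / r + s}.
Proof.
by move=> r s; rewrite -[x]rreprK !rquot_scale_pi -rpiD -mulrDr.
Qed.

HB.instance Definition _ := GRing.Zmodule_isLmodule.Build R^c rquot
  rquot_scaleA rquot_scale1 rquot_scaleDr rquot_scaleDl.

(** The annihilator of the class of s consists of the r with s r in [I]; it is open because left
    multiplication by s is continuous. *)
Lemma rquot_discrete : @discrete_rmod R rquot.
Proof.
move=> x; have [osI _] := oI; have [o _ _] := open_subgroup_mull (rrepr x) osI.
suff -> : [set r : R | (r : R^c) *: x = 0] = [set r | I (rrepr x * r)] by [].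
by apply/seteqP; split=> r /=; rewrite -rpi_eq0.
Qed.

Definition dm_rquot : discreteMod R := DiscreteMod rquot_discrete.

Lemma rquot_ract (s r : R) : @ract R dm_rquot (rpi s) r = rpi (s * r).
Proof. exact: rquot_scale_pi. Qed.

End RightQuotient.

Section RightQuotientMap.
Variables (R : crlRingType) (I J : set R).
Variables (oI : open_right_ideal I) (oJ : open_right_ideal J) (JI : J `<=` I).

Definition rquot_map of J `<=` I := fun x : dm_rquot oJ => rpi oI (rrepr x) : dm_rquot oI.

Lemma rquot_map_pi r : rquot_map JI (rpi oJ r) = rpi oI r.
Proof. by apply/rpi_eq/JI/rpi_eq/rreprK. Qed.

Lemma rquot_map_additive : zmod_morphism (rquot_map JI).
Proof.
have D x y : rquot_map JI (x + y) = rquot_map JI x + rquot_map JI y.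
  by rewrite -[x]rreprK -[y]rreprK -[_ + _]rpiD !rquot_map_pi [LHS]rpiD.
by move=> x y; apply/eqP; rewrite eq_sym subr_eq -D subrK.
Qed.

Lemma rquot_map_scalable : scalable (rquot_map JI).
Proof.
move=> r x; rewrite -[x]rreprK.
rewrite [r *: _](rquot_ract oJ (rrepr x) r) !rquot_map_pi.
by rewrite [RHS](rquot_ract oI (rrepr x) r).
Qed.

HB.instance Definition _ := GRing.isZmodMorphism.Build (dm_rquot oJ) (dm_rquot oI)
  (rquot_map JI) rquot_map_additive.
HB.instance Definition _ := GRing.isScalable.Build R^c (dm_rquot oJ) (dm_rquot oI) _
  (rquot_map JI) rquot_map_scalable.

Lemma rquot_map_surj : range (rquot_map JI) = setT.
Proof.
apply/seteqP; split=> // x _; exists (rpi oJ (rrepr x)) => //.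
by rewrite rquot_map_pi rreprK.
Qed.

End RightQuotientMap.
Arguments rquot_map {R I J} oI oJ JI x.

Section ModuleKernel.
Variables (R : crlRingType) (N N' : discreteMod R) (g : {linear N -> N'}).

Definition lker_pred : {pred N} := [pred y | g y == 0].

Lemma lker_closed : submod_closed lker_pred.
Proof.
split; first by rewrite inE raddf0.
by move=> r x y; rewrite !inE linearP => /eqP -> /eqP ->; rewrite scaler0 addr0.
Qed.

HB.instance Definition _ := GRing.isSubmodClosed.Build R^c N lker_pred lker_closed.

Record dm_ker_sort := DmKer { dm_ker_val : N; _ : dm_ker_val \in lker_pred }.
HB.instance Definition _ := [isSub for dm_ker_val].
HB.instance Definition _ := [Choice of dm_ker_sort by <:].
HB.instance Definition _ := [SubChoice_isSubLmodule of dm_ker_sort by <:].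

Lemma dm_ker_discrete : @discrete_rmod R dm_ker_sort.
Proof.
move=> y; have [o _ _] := open_annihilator (val y).
suff -> : [set r : R | (r : R^c) *: y = 0] = [set r | ract (val y) r = 0] by [].
have vZ (r : R) : val ((r : R^c) *: y) = ract (val y) r by exact: linearZ.
have v0 : val (0 : dm_ker_sort) = 0 by exact: raddf0.
apply/seteqP; split=> r /= h; first by rewrite -vZ h v0.
by apply: val_inj; rewrite vZ h v0.
Qed.

Definition dm_ker : discreteMod R := DiscreteMod dm_ker_discrete.

Definition dm_ker_incl : {linear dm_ker -> N} := (val : dm_ker_sort -> N).

Lemma dm_ker_exact : range g = setT -> short_exact dm_ker_incl g.
Proof.
move=> gS; split=> //.
apply/seteqP; split=> [_ [[x gx] _ <-]|x /= /eqP gx]; first exact/eqP.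
by exists (DmKer gx : dm_ker).
Qed.

End ModuleKernel.

Lemma sum_telescope (V : zmodType) (a : nat -> V) n :
  \sum_(i < n) (a i.+1 - a i) = a n - a 0%N.
Proof. by rewrite -(big_mkord xpredT (fun i => a i.+1 - a i)) telescope_sumr. Qed.

(** * Purity of the kernel of R[[F]] -> F for flat F *)

Section FlatPure.
Variables (R : crlRingType) (F : contramodule R) (flatF : cm_flat F).
Local Notation G := (free_cm R F).
Local Notation q := (free_hom (id : F -> F)).
Local Notation K := (ker_cm q).

Definition lc_scale (X : Type) (r : R) (s : lincomb R X) : lincomb R X :=
  LinComb (cvg_zero_mull r (lcoef_cvg0 s)).

Lemma lc_sumE (X : Type) (J : Type) (s : seq J) (c : J -> lincomb R X) x :
  (\sum_(j <- s) c j) x = \sum_(j <- s) c j x.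
Proof. by elim/big_rec2: _ => // j _ a _ <-. Qed.

Lemma lc_sum_unit (A : {fset F}) (c : F -> R) x :
  (\sum_(p <- A) lc_scale (c p) (lc_unit R p)) x = if x \in A then c x else 0.
Proof.
rewrite lc_sumE; case: ifPn => xA.
  rewrite (big_fsetD1 x) //= asboolT // mulr1 big_seq big1 ?addr0 // => p.
  by rewrite !inE => /andP[/eqP px _]; rewrite asboolF ?mulr0 // => /esym.
rewrite big_seq big1 // => p pA /=; rewrite asboolF ?mulr0 // => px.
by move: xA; rewrite px pA.
Qed.

Lemma free_subE (X : Type) (s t : free_cm R X) (x : X) :
  (s - t : lincomb R X) x = (s : lincomb R X) x - (t : lincomb R X) x.
Proof. by rewrite free_addE free_oppE. Qed.

Definition kcoef (k : K) : lincomb R F := sval k.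

Lemma kcoef0 x : kcoef 0 x = 0.
Proof. by rewrite [kcoef _](raddf0 (ker_incl q)) free_zeroE. Qed.

Lemma kcoefB k l x : kcoef (k - l) x = kcoef k x - kcoef l x.
Proof. by rewrite [kcoef (k - l)](raddfB (ker_incl q)) free_subE. Qed.

(** The multiple [r] [k] is the value of a one-term combination over K whose coefficient is in
    [I]. *)
Lemma ideal_act_ker (I : set R) (oI : open_right_ideal I) (r : R) (k : K) :
  I r -> exists2 k' : K, ideal_act I K k' &
    forall x, kcoef k' x = r * kcoef k x.
Proof.
move=> Ir; have [_ Im] := oI.
exists (cm_pi K (lc_scale r (lc_unit R k))).
  by exists (lc_scale r (lc_unit R k)) => // p /=; exact: Im.
move=> x.
rewrite -[LHS]/(lc_bind kcoef (lc_scale r (lc_unit R k)) x) lc_bindE.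
rewrite (@infsum_single _ _ k) => [|k' kk'] /=.
  by rewrite asboolT // mulr1.
by rewrite asboolF // mulr0 mul0r.
Qed.

Section Step.
Variables (I J : set R).
Variables (oI : open_right_ideal I) (oJ : open_right_ideal J) (JI : J `<=` I).

(* The subgroup J[[F]] + I.K of R[[F]]. *)
Definition step_pred of open_right_ideal I & open_right_ideal J :
    {pred lincomb R F} := [pred s : lincomb R F | `[< exists2 k : K,
  ideal_act I K k & forall x, J (s x - kcoef k x) >]].

Local Notation step_set := (step_pred oI oJ).

Lemma step_setP (s : lincomb R F) : reflect (exists2 k : K,
  ideal_act I K k & forall x, J (s x - kcoef k x)) (s \in step_set).
Proof. exact: asboolP. Qed.

Lemma step_set_coef (s : lincomb R F) : (forall x, J (s x)) -> s \in step_set.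
Proof.
move=> Js; apply/step_setP; exists 0; first exact: ideal_act0.
by move=> x; rewrite kcoef0 subr0.
Qed.

Lemma step_set_ker (k : K) : ideal_act I K k -> kcoef k \in step_set.
Proof.
move=> Ik; apply/step_setP; exists k => // x; rewrite subrr.
by have [[_ J0 _] _] := oJ.
Qed.

Lemma step_set_closed : zmod_closed step_set.
Proof.
have [[_ J0 JB] _] := oJ; split; first exact: step_set_coef.
move=> s t /step_setP[k Ik ks] /step_setP[l Il lt]; apply/step_setP.
exists (k - l) => [|x]; first exact: ideal_actB.
rewrite kcoefB [X in J X](_ : _ = (s x - kcoef k x) - (t x - kcoef l x)); first exact: JB.
by rewrite lc_coefD lc_coefN !opprB addrACA [RHS]addrACA (addrC (- t x)).
Qed.

HB.instance Definition _ :=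
  GRing.isZmodClosed.Build (lincomb R F) step_set step_set_closed.

Local Notation M := (Quotient.quot step_set).

Lemma step_eq (s t : lincomb R F) : s - t \in step_set -> \pi_M s = \pi_M t.
Proof. by move=> h; apply/eqP; rewrite -Quotient.idealrBE. Qed.

(** This kernel is I/J. *)
Local Notation A := (dm_ker (rquot_map oI oJ JI)).

Definition step_repr (a : A) : R := rrepr (val a).

Lemma step_reprI a : I (step_repr a).
Proof.
case: a => x /= xI; apply/(rpi_eq0 oI); rewrite -(rquot_map_pi oI oJ JI) rreprK.
exact/eqP.
Qed.

Lemma step_reprE (a : A) (r : R) : val a = rpi oJ r -> J (step_repr a - r).
Proof. by move=> h; apply/(rpi_eq oJ); rewrite rreprK. Qed.

(** It induces a map from I/J (.) F to R[[F]] / (J[[F]] + I.K), which turns vanishing in I/J (.) F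
    into membership in J[[F]] + I.K. *)
Definition step_fun (a : A) (p : F) : M :=
  \pi_M (lc_scale (step_repr a) (lc_unit R p)).

(** Additivity in [a] holds modulo J[[F]], as representatives add up to an element of [J];
    additivity in [p] holds modulo I.K, as 1(p + p') - 1p - 1p' lies in K. *)
Lemma step_biadditive : biadditive step_fun.
Proof.
have [_ Jm] := oJ; split=> [p a a'|a p p'].
  rewrite /step_fun -pi_quotD; apply: step_eq; apply: step_set_coef => x /=.
  rewrite -mulrDl -mulrBl; apply: Jm; apply: step_reprE.
  by rewrite rpiD !rreprK (raddfD (dm_ker_incl _)).
rewrite /step_fun -pi_quotD; apply: step_eq.
have qk : q ((lc_unit R (p + p') : G) - ((lc_unit R p : G) + (lc_unit R p' : G))) = 0.
  transitivity (q (lc_unit R (p + p')) - (q (lc_unit R p) + q (lc_unit R p'))).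
    by rewrite raddfB raddfD.
  by rewrite !free_hom_unit subrr.
have [k Ik kE] := ideal_act_ker oI (exist _ _ qk) (step_reprI a).
rewrite [X in X \in _](_ : _ = kcoef k); first exact: step_set_ker.
apply: lincombP => x; rewrite kE [kcoef _]/= free_subE free_addE.
by rewrite !lc_coefD lc_coefN lc_coefD /= mulrBr mulrDr.
Qed.

(** The combination 1 pi(t) - t lies in K, so its multiple by a representative in [I] lies in I.K.
    What remains compares the multiple of [t] with a finite sum, coefficientwise modulo [J]. *)
Lemma step_balanced (a : A) (t : lincomb R F) :
  step_fun a (cm_pi F t) = act_sum step_fun a t.
Proof.
have [_ Jm] := oJ; have bi := step_biadditive.
have [D DP] := ract_fset a t.
have vE r : val (ract a r) = rpi oJ (step_repr a * r).
  rewrite -(rquot_ract oJ) rreprK.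
  exact: (linear_ract (dm_ker_incl (rquot_map oI oJ JI))).
rewrite (act_sumE _ DP); last first.
  by move=> p; apply: (addIr (step_fun 0 p)); rewrite -bi.1 !add0r.
rewrite /step_fun -(big_morph _ (@pi_quotD _ _) (@pi_quot0 _ _)); apply: step_eq.
have qk : q ((lc_unit R (cm_pi F t) : G) - (t : G)) = 0.
  by rewrite raddfB [X in X - _]free_hom_unit /= lc_map_id subrr.
have [k Ik kE] := ideal_act_ker oI (exist _ _ qk) (step_reprI a).
rewrite -[X in X \in _](subrK (kcoef k)).
apply: rpredD; last exact: step_set_ker.
apply: step_set_coef => x; rewrite !lc_coefD !lc_coefN kE [kcoef _]/= free_subE.
rewrite lc_sum_unit /= mulrBr.
rewrite [X in J X](_ : _ = step_repr a * t x -
    (if x \in D then step_repr (ract a (t x)) else 0)); last first.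
  by rewrite opprB addrC addrA subrK.
case: ifPn => xD; last first.
  by rewrite subr0; apply/(rpi_eq0 oJ); rewrite -vE DP // (raddf0 (dm_ker_incl _)).
have [[_ J0 JB] _] := oJ; apply: (subgroup_sym J0 JB).
exact: step_reprE.
Qed.

(* Flatness is applied to the inclusion of I/J into R/J: the class of [s] in
   I/J (.) F maps to 1 (.) pi(s) = 0. *)
Lemma flat_step (s : lincomb R F) : q (s : G) = 0 -> (forall x, I (s x)) ->
  exists2 k : K, ideal_act I K k & forall x, J (s x - kcoef k x).
Proof.
move=> qs sI; have [osJ Jm] := oJ; have [_ J0 JB] := osJ.
have [inj _ _] := flatF (dm_ker_exact (rquot_map_surj oI oJ JI)).
have aP x : rpi oJ (s x) \in lker_pred (rquot_map oI oJ JI).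
  by rewrite inE [X in X == _]rquot_map_pi; apply/eqP/rpi_eq0.
pose a x : A := DmKer (aP x).
have [D DP] := @ract_fset R (dm_rquot oJ) F (rpi oJ 1) s.
have aD x : x \notin D -> J (s x).
  by move=> /DP; rewrite rquot_ract mul1r => /rpi_eq0.
(* The class of [s] in I/J (.) F is a finite sum, because coefficients outside [D] are already in
   [J]. *)
pose z : contratensor A F := \sum_(x <- D) ct (a x) x.
have z0 : z = 0.
  apply: inj; rewrite raddf0 /z raddf_sum.
  transitivity (@ct R (dm_rquot oJ) F (rpi oJ 1) (cm_pi F s)); last first.
    by rewrite -[cm_pi F s](congr1 (cm_pi F) (lc_map_id s)) [X in ct _ X]qs ct0r.
  rewrite ct_cm_pi (act_sumE _ DP); last exact: ct0l.
  by apply: eq_bigr => x _; rewrite [LHS]contratensor_map_ct rquot_ract mul1r.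
(* The lift of [step_fun] sends [z] to the class of [s] modulo J[[F]] + I.K; its vanishing provides
   [k]. *)
have := congr1 (ct_lift step_biadditive step_balanced) z0.
rewrite raddf0 raddf_sum (eq_bigr (fun x => step_fun (a x) x)); last first.
  by move=> x _; exact: ct_liftE.
rewrite /step_fun -(big_morph _ (@pi_quotD _ _) (@pi_quot0 _ _)) => /eqP.
rewrite -(pi_quot0 step_set) -Quotient.idealrBE subr0 => /step_setP[k Ik kP].
exists k => // x; apply: (subgroup_trans J0 JB _ (kP x)).
rewrite lc_sum_unit; case: ifPn => [xD|/aD]; last by rewrite subr0.
exact/(subgroup_sym J0 JB)/step_reprE.
Qed.

End Step.

Variables (I : nat -> set R) (dI : decreasing_base I).

Lemma flat_pure (k : K) : (forall x, I 0%N (kcoef k x)) ->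
  ideal_act (I 0%N) K k.
Proof.
move=> kI; have [oI dec _] := dI.
(* If the coefficients of [l] lie in I_n, an element of I_n.K from [flat_step] is subtracted;
   otherwise [l] is the default. *)
have /choice[next nextP] : forall nk : nat * K, exists k' : K,
    (forall x, I nk.1 (kcoef nk.2 x)) ->
    ideal_act (I nk.1) K (k' - nk.2) /\
    forall x, I nk.1.+1 (kcoef k' x).
  move=> [n l] /=; have [h|] := pselect (forall x, I n (kcoef l x)); last first.
    by exists l.
  have [l' Il' l'P] := flat_step (oI n) (oI n.+1) (@dec n) (svalP l) h.
  exists (l - l') => _; split=> [|x]; last by rewrite kcoefB.
  rewrite [X in ideal_act _ _ X](_ : _ = 0 - l'); last by rewrite addrAC subrr.
  by apply: ideal_actB => //; exact: ideal_act0.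
pose seqk := fix seqk n := if n is n'.+1 then next (n', seqk n') else k.
have seqI n x : I n (kcoef (seqk n) x).
  by elim: n x => [|n IH] //; exact: (nextP (n, seqk n) IH).2.
have zI n : ideal_act (I n) K (seqk n.+1 - seqk n).
  exact: (nextP (n, seqk n) (seqI n)).1.
have k0 : seqk 0%N = k by [].
move: seqk seqI zI k0 => seqk seqI zI k0.
have [y yP] := contramodule_series dI zI.
(* The partial sums telescope to k_n - k and k_n has coefficients in I_n, so [y + k] has
   coefficients in every I_n. *)
suff yk : y + k = 0.
  have -> : k = 0 - y by rewrite -yk addrAC subrr add0r.
  apply: ideal_actB; [exact: oI|exact: ideal_act0|].
  by have := yP 0%N; rewrite big_ord0 subr0.
apply: sval_prop_inj; apply: lincombP => x; rewrite -/(kcoef _) -/(kcoef 0) kcoef0.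
apply: (decreasing_base_eq0 dI) => n.
have := ideal_act_free (oI n) (ideal_act_hom (oI n) (ker_incl q) (yP n)) x.
rewrite sum_telescope k0 opprB addrA -[ker_incl q _]/(kcoef _) kcoefB => h.
have [[_ I0 IB] _] := oI n.
by have := subgroupD I0 IB h (seqI n x); rewrite subrK.
Qed.

End FlatPure.

Lemma flat_separated (R : crlRingType) (F : contramodule R) :
  countable_base0 R -> cm_flat F -> cm_separated F.
Proof.
move=> /decreasing_base_exists[I dI] flatF; have [oI _ _] := dI.
apply/seteqP; split=> [p pI|_ ->]; last first.
  by move=> J oJ; exact: ideal_act0.
pose q := free_hom (id : F -> F); pose K := ker_cm q.
pose s : free_cm R F := lc_unit R p.
(* Lifts of [p] to R[[F]] whose coefficients tend to zero with [n]. *)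
have /choice[t tP] n : exists t : lincomb R F, (forall x, I n (t x)) /\ cm_pi F t = p.
  by have [t tI tp] := pI _ (oI n); exists t.
have kP n : q (s - (t n : free_cm R F)) = 0.
  by rewrite raddfB [X in X - _]free_hom_unit /= lc_map_id (tP n).2 subrr.
(* These elements of K converge to [s] coefficientwise; the aim is to show that [s] is in K. *)
pose k n : K := exist _ _ (kP n).
have kE n x : kcoef (k n) x = (s : lincomb R F) x - t n x by exact: free_subE.
(* Consecutive terms differ by [t n - t n.+1], with coefficients in I_n; purity places the
   difference in I_n.K, so the series can be summed in K itself. *)
have kI n : ideal_act (I n) K (k n.+1 - k n).
  have := @flat_pure R F flatF _ (decreasing_base_shift n dI) (k n.+1 - k n).
  rewrite !addn0; apply=> x; rewrite kcoefB !kE.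
  rewrite [X in I _ X](_ : _ = t n x - t n.+1 x); last by rewrite opprB addrC subrKA.
  have [[_ I0 IB] _] := oI n; apply: IB; first exact: (tP n).1.
  by apply: (decreasing_base_le dI (leqnSn n)); exact: (tP n.+1).1.
have [y yP] := contramodule_series dI kI.
suff sE : s = sval (y + k 0%N).
  have qs : q s = p by exact: free_hom_unit.
  by rewrite /= -qs sE; exact: (proj2_sig (y + k 0%N : {l | q l = 0})).
apply: lincombP => x; apply/eqP; rewrite -subr_eq0; apply/eqP.
apply: (decreasing_base_eq0 dI) => n.
have := ideal_act_free (oI n) (ideal_act_hom (oI n) (ker_incl q) (yP n)) x.
rewrite sum_telescope opprB addrA -[ker_incl q _]/(kcoef _) kcoefB kE => h.
have [[_ I0 IB] _] := oI n.
have := subgroupD I0 IB (subgroup_sym I0 IB h) ((tP n).1 x).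
by rewrite addrAC subrK.
Qed.

(** * Equivalence of full faithfulness on flat, separated and all contramodules *)

Theorem theorem7p4 (R S : crlRingType)
    (hR : countable_base0 R) (hS : countable_base0 S)
    (f : {rmorphism R -> S}) (fc : continuous f)
    (f_flat : forall F : contramodule S, cm_flat F -> cm_flat (res fc F)) :
  (res_fully_faithful fc (fun P => cm_flat P) <->
   res_fully_faithful fc (fun P => cm_separated P)) /\
  (res_fully_faithful fc (fun P => cm_separated P) <->
   res_fully_faithful fc (fun _ => True)).
Proof.
have full_sep : res_fully_faithful fc (fun _ => True) ->
    res_fully_faithful fc (fun P => cm_separated P).
  by move=> ff P Q _ _; exact: ff.
have sep_flat : res_fully_faithful fc (fun P => cm_separated P) ->
    res_fully_faithful fc (fun P => cm_flat P).
  by move=> ff P Q fP fQ; apply: ff; exact: flat_separated.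
have flat_full := res_full_flat f_flat.
split; split=> ff.
- exact: full_sep (flat_full ff).
- exact: sep_flat ff.
- exact: flat_full (sep_flat ff).
- exact: full_sep ff.
Qed.
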